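(* Let $w$ be a positive word in $a,b$, not a power of $a$ or of $b$, such that $h_a:=h_a(w)$ is a prime number. For an interval $I\subset\mathbb{R}$ let $\Gamma(I)=\{(x,\mathrm{fr}_w(x)) : x\in I\cap\mathbb{Q}\}$ be the graph of the fringe length function over $I$. Let $\Delta_1=(0,1/h_a)$, decomposed (up to the common endpoint $1/(h_a+1)$) into $I_{1,1}=(0,1/(h_a+1))$ and $I_{1,2}=(1/(h_a+1),1/h_a)$. Then: (i) the map $T_{1,1}(x,y)=\left(\frac{x}{1-h_ax},\frac{y}{1-h_ax}\right)$ maps $\Gamma(I_{1,1})$ bijectively onto $\Gamma((0,1))$; (ii) the map $T_{1,2}(x,y)=\left(\frac{(h_a+1)x-1}{h_a^2x-(h_a-1)},\frac{y}{h_a^2x-(h_a-1)}\right)$ maps $\Gamma(I_{1,2})$ bijectively onto $\Gamma(\Delta_1)$.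
   Context: $\mathrm{Homeo}_+^\sim(S^1)$ is the group of orientation-preserving homeomorphisms of $\mathbb{R}$ commuting with the translation $x\mapsto x+1$. For $f\in \mathrm{Homeo}_+^\sim(S^1)$, the (real-valued) rotation number is $\mathrm{rot}^\sim(f)=\lim_{n\to\infty} f^n(0)/n\in\mathbb{R}$. $F$ is the free group on $a,b$. A word $w\in F$ is positive if it lies in the semigroup generated by $a$ and $b$ (only positive powers occur); $h_a(w)$ and $h_b(w)$ denote the numbers of $a$'s and $b$'s in $w$. For $r,s\in\mathbb{R}$, $R(w;r,s)$ is the maximum of $\mathrm{rot}^\sim(\rho(w))$ over all homomorphisms $\rho:F\to\mathrm{Homeo}_+^\sim(S^1)$ with $\mathrm{rot}^\sim(\rho(a))=r$ and $\mathrm{rot}^\sim(\rho(b))=s$ (the maximum is known to be attained). It is known (Calegari-Walker) that for $w$ positive and not a power of $a$ or $b$, and $r$ rational, there is a least rational number $s\in[0,1)$ such that $R(w;r,t)=h_a(w)r+h_b(w)$ for all $t\in[s,1)$. The fringe length of $r$ is $\mathrm{fr}_w(r):=1-s$. *)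

(* Defs.v *)
From HB Require Import structures.
From mathcomp Require Import all_boot all_order all_algebra.
From mathcomp Require Import all_classical all_reals all_analysis.
Set Implicit Arguments.
Unset Strict Implicit.
Unset Printing Implicit Defensive.
Import Order.TTheory GRing.Theory Num.Theory.
Import numFieldNormedType.Exports.
Local Open Scope classical_set_scope.
Local Open Scope ring_scope.

(* Positive words of the free group on a, b: sequences over two letters. *)
Definition letter : Type := bool.
Definition la : letter := true.
Definition lb : letter := false.
Definition word : Type := seq letter.

Definition h_a (w : word) : nat := count (fun c : bool => c == la) w.
Definition h_b (w : word) : nat := count (fun c : bool => c == lb) w.

Definition is_power (c : letter) (w : word) : Prop :=
  exists k : nat, w = nseq k c.

Section Ziggurat.
Variable R : realType.

(* Membership in Homeo_+^~(S^1); for a homeomorphism of the line,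
   orientation-preserving means increasing. *)
Definition homeo_lift (f : R -> R) : Prop :=
  [/\ continuous f,
      exists g : R -> R, [/\ continuous g, cancel f g & cancel g f],
      {homo f : x y / x < y} &
      forall x, f (x + 1) = f x + 1].

Definition rot (f : R -> R) : R := limn (fun n : nat => iter n f 0 / n%:R).

(* A homomorphism from the free group is determined by the arbitrary images
   f of a and g of b; this is the image of the positive word w under it. *)
Definition word_map (f g : R -> R) (w : word) : R -> R :=
  foldr (fun (c : letter) (h : R -> R) => (if c then f else g) \o h) id w.

Definition rot_values (w : word) (r s : R) : set R :=
  [set x | exists f g : R -> R,
     [/\ homeo_lift f, homeo_lift g, rot f = r, rot g = s &
         x = rot (word_map f g w)]].

(* R(w; r, s): the maximum of rot_values w r s.  The maximum is always
   attained, so the default value 0 is never used. *)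
Definition max_rot (w : word) (r s : R) : R :=
  xget 0 (rot_values w r s `&` ubound (rot_values w r s)).

Definition in_fringe (w : word) (r s : rat) : Prop :=
  (0 <= s < 1) /\
  forall t : R, ratr s <= t < 1 ->
    max_rot w (ratr r) t = (h_a w)%:R * ratr r + (h_b w)%:R.

(* The least rational s with in_fringe w r s; it exists when w is not a power
   of a or of b, and the default value 0 is then not used. *)
Definition fringe_start (w : word) (r : rat) : rat :=
  xget 0 ([set s | in_fringe w r s] `&` lbound [set s | in_fringe w r s]).

Definition fringe_length (w : word) (r : rat) : rat := 1 - fringe_start w r.

Definition fringe_graph (w : word) (I : set R) : set (R * R) :=
  [set (ratr x, ratr (fringe_length w x)) | x in [set x : rat | I (ratr x)]].

Definition T11 (h : nat) (z : R * R) : R * R :=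
  (z.1 / (1 - h%:R * z.1), z.2 / (1 - h%:R * z.1)).

Definition T12 (h : nat) (z : R * R) : R * R :=
  (((h%:R + 1) * z.1 - 1) / (h%:R ^+ 2 * z.1 - (h%:R - 1)),
   z.2 / (h%:R ^+ 2 * z.1 - (h%:R - 1))).

End Ziggurat.

(* Main.v *)
From mathcomp Require Import all_boot all_order all_algebra.
From mathcomp Require Import all_classical all_reals all_analysis.
From mathcomp Require Import ring lra zify.
Require Import Defs.
Set Implicit Arguments.
Unset Strict Implicit.
Unset Printing Implicit Defensive.
Import Order.TTheory GRing.Theory Num.Theory.
Import numFieldNormedType.Exports.
Local Open Scope classical_set_scope.
Local Open Scope ring_scope.

(** Let h and l be the numbers of a's and b's in w, and let r = p / q > 0 be in
    lowest terms.  The theorem follows from a formula for the fringe length at r.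

    If rot g < 1 then g lies below the translation by 1, hence
    rot (w (f, g)) <= h r + l ([rot_word_le]).  The fringe of r therefore
    consists of those t < 1 for which some pair with rot f = r and rot g = t
    reaches this bound.

    Up to conjugation w is a product of blocks in which one f is followed by a
    run of g's; let beta k be the length of run number k, a sequence of period
    h.  A periodic orbit of f cuts the line into gaps, which f permutes like the
    rotation by p / q.  If the bound is reached, an orbit of w exists along which
    every run of g's stays, up to translation, inside one gap
    ([periodic_block_levels]).  The gap visited after k letters a receives the
    runs beta (k + v q) for all v; let M k be the largest of them and S the sum
    of M k over k < q.  The map g needs at least M k steps to go down through
    that gap relative to the translation by 1, so g ^ S loses at most one unit
    and rot g >= 1 - 1 / S ([rot_ge_of_runs]).  Conversely, an f that pushes
    everything to the tops of the gaps and a g that descends through them in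
    exactly S steps reach the bound with rot g = 1 - 1 / S ([extremal_pair]), and
    moving g up gives all larger t.  Hence the fringe length at r is 1 / S
    ([fringe_length_rat]).

    As beta has period h, the function M depends on q only modulo h, and S / q is
    the mean value of M.  So q times the fringe length depends only on q modulo h
    ([run_sum_congr]).  The first coordinates of both maps of the theorem are
    transformations (a x + b) / (c x + d) with a d - b c = 1, c divisible by h
    and d congruent to 1 modulo h.  They multiply denominators by c x + d and
    preserve them modulo h, so they divide the fringe length by c x + d
    ([fringe_length_moebius]), which is what the second coordinates do. *)

(** * Increasing maps of degree one *)

Section Lifts.
Variable R : realType.
Implicit Types (f g : R -> R) (x y : R) (n : nat).

Lemma homeo_lift_lt f : homeo_lift f -> {homo f : x y / x < y}.
Proof. by case. Qed.

Lemma homeo_lift_le f : homeo_lift f -> {homo f : x y / x <= y}.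
Proof. by case=> _ _ f_lt _; apply: ltW_homo. Qed.

Lemma homeo_lift_mono f : homeo_lift f -> {mono f : x y / x <= y}.
Proof. by move=> /homeo_lift_lt; apply: le_mono. Qed.

Lemma homeo_lift1 f : homeo_lift f -> forall x, f (x + 1) = f x + 1.
Proof. by case. Qed.

Lemma shift_nat f : (forall x, f (x + 1) = f x + 1) ->
  forall n x, f (x + n%:R) = f x + n%:R.
Proof.
move=> f1; elim=> [|n IHn] x; first by rewrite !addr0.
by rewrite -natr1 addrA f1 IHn addrA.
Qed.

Lemma shift_int f : (forall x, f (x + 1) = f x + 1) ->
  forall (k : int) x, f (x + k%:~R) = f x + k%:~R.
Proof.
move=> f1 [n|n] x; first exact: shift_nat.
rewrite NegzE mulrNz; apply/eqP; rewrite -subr_eq opprK; apply/eqP.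
by rewrite -[in RHS](subrK (n.+1)%:~R x) (shift_nat f1).
Qed.

Lemma homeo_lift_id : homeo_lift (id : R -> R).
Proof.
have idc : continuous (id : R -> R) by move=> x; exact: cvg_id.
by split=> //; exists id.
Qed.

Lemma homeo_lift_comp f g :
  homeo_lift f -> homeo_lift g -> homeo_lift (f \o g).
Proof.
move=> [fc [f' [f'c fK f'K]] f_lt f1] [gc [g' [g'c gK g'K]] g_lt g1]; split.
- by move=> x; apply: continuous_comp; [exact: gc|exact: fc].
- exists (g' \o f'); split.
  + by move=> x; apply: continuous_comp; [exact: f'c|exact: g'c].
  + by move=> x /=; rewrite fK gK.
  + by move=> x /=; rewrite g'K f'K.
- by move=> x y xy /=; apply/f_lt/g_lt.
- by move=> x /=; rewrite g1 f1.
Qed.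

Lemma homeo_lift_iter f n : homeo_lift f -> homeo_lift (iter n f).
Proof.
move=> hf; elim: n => [|n IHn]; first exact: homeo_lift_id.
exact: (homeo_lift_comp hf IHn).
Qed.

Lemma homeo_lift_word f g w :
  homeo_lift f -> homeo_lift g -> homeo_lift (word_map f g w).
Proof.
move=> hf hg; elim: w => [|c w IHw]; first exact: homeo_lift_id.
by case: c; apply: homeo_lift_comp.
Qed.

(** A jump of a monotone map would leave a gap in its image. *)
Lemma increasing_bij_continuous f g :
  {homo f : x y / x < y} -> cancel f g -> cancel g f -> continuous f.
Proof.
move=> f_lt fK gK x; apply/cvgrPdist_lt => e e0.
have g_lt : {homo g : a b / a < b}.
  move=> a b ab; rewrite ltNge; apply/negP => gba.
  have := ltW_homo f_lt gba.
  by rewrite !gK leNgt ab.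
have lx : g (f x - e) < x by rewrite -[ltRHS]fK; apply: g_lt; rewrite ltrBlDr ltrDl.
have xr : x < g (f x + e) by rewrite -[ltLHS]fK; apply: g_lt; rewrite ltrDl.
have : \forall y \near x, y \in `]g (f x - e), g (f x + e)[.
  by apply: near_in_itvoo; rewrite in_itv /= lx xr.
apply: filterS => y; rewrite in_itv /= => /andP[/f_lt + /f_lt].
by rewrite !gK => ly yr; rewrite ltr_distlC ly yr.
Qed.

Lemma homeo_lift_bij f g :
  {homo f : x y / x < y} -> (forall x, f (x + 1) = f x + 1) ->
  cancel f g -> cancel g f -> homeo_lift f /\ homeo_lift g.
Proof.
move=> f_lt f1 fK gK.
have g_lt : {homo g : a b / a < b}.
  move=> a b ab; rewrite ltNge; apply/negP => gba.
  have := ltW_homo f_lt gba.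
  by rewrite !gK leNgt ab.
have fc := increasing_bij_continuous f_lt fK gK.
have gc := increasing_bij_continuous g_lt gK fK.
split; split=> //; [by exists g|by exists f|].
by move=> x; apply: (can_inj fK); rewrite f1 !gK.
Qed.

(** Degree one makes the map unbounded in both directions, so the
    intermediate value theorem yields an inverse. *)
Lemma continuous_homeo_lift f :
  {homo f : x y / x < y} -> (forall x, f (x + 1) = f x + 1) ->
  continuous f ->
  exists g, [/\ homeo_lift f, homeo_lift g, cancel f g & cancel g f].
Proof.
move=> f_lt f1 fc.
have surj y : exists x, f x = y.
  pose n := Num.truncn (`|y - f 0|).
  have yn : `|y - f 0| < n.+1%:R by exact: truncnS_gt.
  move: yn; rewrite ltr_norml => /andP[yl yr].
  have [x _ <-] : exists2 c, c \in `[- n.+1%:R, n.+1%:R] & f c = y; last by exists x.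
  have e1 : f (- n.+1%:R) = f 0 - n.+1%:R.
    have := shift_int f1 (- (n.+1)%:Z) 0.
    by rewrite add0r mulrNz.
  have e2 : f n.+1%:R = f 0 + n.+1%:R by rewrite -(shift_nat f1) add0r.
  apply: IVT.
  - by rewrite ge0_cp.
  - exact: continuous_subspaceT.
  - rewrite e1 e2 ge_min le_max.
    apply/andP; split; apply/orP; [left|right]; lra.
have [g gK] := choice surj.
have fK : cancel f g.
  by move=> x; apply: (inc_inj (le_mono f_lt)); rewrite gK.
by have [hf hg] := homeo_lift_bij f_lt f1 fK gK; exists g.
Qed.

Lemma lipschitz_continuous f (C : R) :
  (forall x y, x <= y -> 0 <= f y - f x <= C * (y - x)) -> continuous f.
Proof.
move=> fC x; apply/cvgrPdist_le => e e0.
pose D := `|C| + 1.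
have D0 : 0 < D by rewrite ltr_wpDl.
have idx : id y @[y --> x] --> x by exact: cvg_id.
near=> y.
have xy : `|x - y| <= e / D.
  near: y; move/cvgrPdist_le : idx; apply.
  by rewrite divr_gt0.
apply: (@le_trans _ _ (D * `|x - y|)); last by rewrite mulrC -ler_pdivlMr.
have CD : C <= D by rewrite /D; have := ler_norm C; lra.
have [xley|/ltW ylex] := leP x y.
- have /andP[h1 h2] := fC _ _ xley.
  rewrite distrC (ger0_norm h1) distrC ger0_norm ?subr_ge0//.
  by apply: (le_trans h2); rewrite ler_wpM2r// subr_ge0.
- have /andP[h1 h2] := fC _ _ ylex.
  rewrite (ger0_norm h1) ger0_norm ?subr_ge0//.
  by apply: (le_trans h2); rewrite ler_wpM2r// subr_ge0.
Unshelve. all: by end_near. Qed.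

End Lifts.

(** * Rotation numbers *)

Section RotationNumber.
Variable R : realType.
Implicit Types (f g : R -> R) (x y : R) (n : nat).

Lemma archimedean_le0 (a C : R) : (forall n, n%:R * a <= C) -> a <= 0.
Proof.
move=> aC; rewrite leNgt; apply/negP => a0.
have := aC (Num.truncn (C / a)).+1.
by apply/negP; rewrite -ltNge -ltr_pdivrMr// truncnS_gt.
Qed.

(** Compare x with the neighbouring integers, which move exactly as 0 does. *)
Lemma displacement_close f x : homeo_lift f -> `|f x - x - f 0| <= 1.
Proof.
move=> hf; have f1 := homeo_lift1 hf.
have := floor_le x; have := floorD1_gt x; set k := Num.floor x => xk kx.
have e1 : f k%:~R = f 0 + k%:~R by rewrite -(shift_int f1) add0r.
have e2 : f (k + 1)%:~R = f 0 + (k + 1)%:~R by rewrite -(shift_int f1) add0r.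
have := homeo_lift_le hf kx; have := homeo_lift_le hf (ltW xk).
move: xk; rewrite e1 e2 !intrD => xk h1 h2.
by rewrite ler_norml; apply/andP; split; lra.
Qed.

(** The displacement of f^n is nearly constant, so f^(m n)(0) is m times f^n(0)
    up to an error that does not depend on n. *)
Lemma iter_close f m n : homeo_lift f ->
  `|iter (m * n) f 0 - m%:R * iter n f 0| <= m%:R.
Proof.
move=> hf; elim: m => [|m IHm]; first by rewrite !mul0r subr0 normr0.
rewrite mulSn iterD.
have := displacement_close (iter (m * n) f 0) (homeo_lift_iter n hf).
move: IHm; rewrite !ler_norml -natr1 => /andP[h1 h2] /andP[h3 h4].
by apply/andP; split; lra.
Qed.

(** By [iter_close] every (f^n(0) - 1) / n lies below every (f^m(0) + 1) / m;
    the number rho separates these two families. *)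
Lemma translation_number_exists f : homeo_lift f ->
  exists rho : R, forall n, `|iter n f 0 - n%:R * rho| <= 1.
Proof.
move=> hf; pose a n := iter n f 0.
pose E := [set (a n.+1 - 1) / n.+1%:R | n in [set: nat]].
have cross m n : (a n.+1 - 1) / n.+1%:R <= (a m.+1 + 1) / m.+1%:R.
  rewrite ler_pdivrMr ?ltr0n// mulrAC ler_pdivlMr ?ltr0n//.
  have := iter_close m.+1 n.+1 hf; have := iter_close n.+1 m.+1 hf.
  rewrite [(n.+1 * _)%N]mulnC -/(a _) -/(a n.+1) -/(a m.+1) !ler_norml.
  by move=> /andP[h1 h2] /andP[h3 h4]; lra.
have ubE m : ubound E ((a m.+1 + 1) / m.+1%:R) by move=> _ [n _ <-].
have supE : has_sup E.
  by split; [exists ((a 1%N - 1) / 1%:R), 0%N|exists ((a 1%N + 1) / 1%:R); exact: ubE].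
exists (sup E) => -[|n]; first by rewrite mul0r subr0 normr0.
have l : (a n.+1 - 1) / n.+1%:R <= sup E.
  by apply: (sup_upper_bound supE); exists n.
have u : sup E <= (a n.+1 + 1) / n.+1%:R by apply: sup_le_ub; [case: supE|exact: ubE].
move: l u; rewrite ler_pdivrMr ?ltr0n// ler_pdivlMr ?ltr0n// -/(a _).
by rewrite ler_norml => l u; apply/andP; split; lra.
Qed.

Lemma rot_close f n : homeo_lift f -> `|iter n f 0 - n%:R * rot f| <= 1.
Proof.
move=> hf; have [rho rhoP] := translation_number_exists hf.
suff -> : rot f = rho by [].
apply: cvg_lim => //; apply/cvgrPdist_le => e e0.
near=> m.
have m0 : (0 < m)%N by near: m; exact: nbhs_infty_gt.
have em : 1 <= m%:R * e.
  rewrite -ler_pdivrMr// mul1r; near: m; exact: nbhs_infty_ger.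
have m0R : (0 : R) < m%:R by rewrite ltr0n.
have := rhoP m; rewrite -{1}[iter m f 0](divfK (lt0r_neq0 m0R)).
rewrite !ler_norml => /andP[h1 h2].
by apply/andP; split; rewrite -(ler_pM2l m0R); lra.
Unshelve. all: by end_near. Qed.

Lemma rot_unique f (rho C : R) : homeo_lift f ->
  (forall n, `|iter n f 0 - n%:R * rho| <= C) -> rot f = rho.
Proof.
move=> hf rhoP; apply/eqP; rewrite eq_le -subr_le0 -[X in _ && X]subr_le0.
apply/andP; split; apply: (@archimedean_le0 _ (C + 1)) => n;
  have := rhoP n; have := rot_close n hf; rewrite !ler_norml;
  by move=> /andP[h1 h2] /andP[h3 h4]; lra.
Qed.

Lemma rot_close_at f n x : homeo_lift f ->
  `|iter n f x - x - n%:R * rot f| <= 2.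
Proof.
move=> hf; have := displacement_close x (homeo_lift_iter n hf).
have := rot_close n hf; rewrite !ler_norml => /andP[h1 h2] /andP[h3 h4].
by apply/andP; split; lra.
Qed.

Lemma iter_ge f (x a : R) : (forall y, y + a <= f y) ->
  forall n, x + n%:R * a <= iter n f x.
Proof.
move=> fa; elim=> [|n IHn]; first by rewrite mul0r addr0.
by have := fa (iter n f x); rewrite -natr1 /=; lra.
Qed.

Lemma iter_le f (x a : R) : (forall y, f y <= y + a) ->
  forall n, iter n f x <= x + n%:R * a.
Proof.
move=> fa; elim=> [|n IHn]; first by rewrite mul0r addr0.
by have := fa (iter n f x); rewrite -natr1 /=; lra.
Qed.

Lemma rot_ge f m (N : nat) x : homeo_lift f -> (0 < m)%N ->
  x + N%:R <= iter m f x -> N%:R / m%:R <= rot f.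
Proof.
move=> hf m0 fx; have hm := homeo_lift_iter m hf.
have h n : x + n%:R * N%:R <= iter (n * m) f x.
  elim: n => [|n IHn]; first by rewrite mul0r addr0.
  rewrite mulSn iterD; apply: le_trans (homeo_lift_le hm IHn).
  rewrite -(natrM _ n N) (shift_nat (homeo_lift1 hm)) natrM -natr1.
  by move: fx; lra.
rewrite ler_pdivrMr ?ltr0n// -subr_le0; apply: (@archimedean_le0 _ 2) => n.
have := rot_close_at (n * m) x hf; have := h n.
by rewrite ler_norml natrM => h1 /andP[_ h2]; lra.
Qed.

Lemma rot_le f m (N : nat) x : homeo_lift f -> (0 < m)%N ->
  iter m f x <= x + N%:R -> rot f <= N%:R / m%:R.
Proof.
move=> hf m0 fx; have hm := homeo_lift_iter m hf.
have h n : iter (n * m) f x <= x + n%:R * N%:R.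
  elim: n => [|n IHn]; first by rewrite mul0r addr0.
  rewrite mulSn iterD; apply: le_trans (homeo_lift_le hm IHn) _.
  rewrite -(natrM _ n N) (shift_nat (homeo_lift1 hm)) natrM -natr1.
  by move: fx; lra.
rewrite ler_pdivlMr ?ltr0n// -subr_le0; apply: (@archimedean_le0 _ 2) => n.
have := rot_close_at (n * m) x hf; have := h n.
by rewrite ler_norml natrM => h1 /andP[h2 _]; lra.
Qed.

Lemma rot_periodic f m (N : nat) x : homeo_lift f -> (0 < m)%N ->
  iter m f x = x + N%:R -> rot f = N%:R / m%:R.
Proof.
move=> hf m0 fx; apply/eqP; rewrite eq_le.
by rewrite (rot_le hf m0 (x := x)) ?(rot_ge hf m0 (x := x)) ?fx.
Qed.

Lemma displacement_periodic f x : homeo_lift f ->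
  exists2 y, y \in `[0, 1] & f x - x = f y - y.
Proof.
move=> hf; exists (x - (Num.floor x)%:~R).
  have := floor_le x; have := floorD1_gt x; rewrite intrD => xk kx.
  by rewrite in_itv /= subr_ge0 kx lerBlDl ltW.
by rewrite -mulrNz (shift_int (homeo_lift1 hf)) mulrNz; ring.
Qed.

(** If the displacement never equals the rotation number N then, by
    compactness of a period, it stays away from N on one side, and the iterates
    drift away linearly from the expected position. *)
Lemma rot_nat_fixpoint f (N : nat) : homeo_lift f -> rot f = N%:R ->
  exists x, f x = x + N%:R.
Proof.
move=> hf rotN; pose d x := f x - x.
have dc : continuous d.
  move=> x; apply: cvgB; last exact: cvg_id.
  by case: hf => fc _ _ _; exact: fc.
have dcw (A : set R) : {within A, continuous d} by exact: continuous_subspaceT.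
have [cmin _ dmin] := EVT_min (@ler01 R) (dcw _).
have [cmax _ dmax] := EVT_max (@ler01 R) (dcw _).
have dmin_le y : y + d cmin <= f y.
  have [z /dmin + fyz] := displacement_periodic y hf.
  by rewrite /d -fyz; lra.
have dmax_ge y : f y <= y + d cmax.
  have [z /dmax + fyz] := displacement_periodic y hf.
  by rewrite /d -fyz; lra.
have low : d cmin <= N%:R.
  rewrite -subr_le0; apply: (@archimedean_le0 _ 1) => n.
  have := rot_close n hf; have := iter_ge 0 dmin_le n.
  by rewrite rotN add0r ler_norml => h0 /andP[_ h1]; lra.
have high : N%:R <= d cmax.
  rewrite -subr_le0; apply: (@archimedean_le0 _ 1) => n.
  have := rot_close n hf; have := iter_le 0 dmax_ge n.
  by rewrite rotN add0r ler_norml => h0 /andP[h1 _]; lra.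
have [c _ dcN] : exists2 c, c \in `[Num.min cmin cmax, Num.max cmin cmax] & d c = N%:R.
  apply: IVT; [by rewrite ge_min le_max lexx|exact: dcw|].
  case: (leP cmin cmax) => _; rewrite ge_min le_max low high ?orbT//.
by exists c; rewrite -dcN /d addrC subrK.
Qed.

Lemma rot_iter f m : homeo_lift f -> rot (iter m f) = m%:R * rot f.
Proof.
move=> hf; apply: (@rot_unique _ _ 1); first exact: homeo_lift_iter.
move=> n; have := rot_close (n * m) hf.
by rewrite natrM -mulrA iterM.
Qed.

Lemma rot_rat_periodic f m (N : nat) : homeo_lift f -> (0 < m)%N ->
  rot f = N%:R / m%:R -> exists x, iter m f x = x + N%:R.
Proof.
move=> hf m0 rotf; apply: rot_nat_fixpoint; first exact: homeo_lift_iter.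
by rewrite rot_iter// rotf mulrC divfK// pnatr_eq0 -lt0n.
Qed.

Lemma homeo_lift_translate f (l : R) :
  homeo_lift f -> homeo_lift (fun x => f x + l).
Proof.
case=> fc [g [gc fK gK]] f_lt f1.
have := @homeo_lift_bij R (fun x => f x + l) (fun y => g (y - l)).
case=> //.
- by move=> x y xy; rewrite ltrD2r f_lt.
- by move=> x; rewrite f1 addrAC.
- by move=> x /=; rewrite addrK fK.
- by move=> x /=; rewrite gK subrK.
Qed.

(** Each iterate at 0 depends continuously on the translation parameter, and
    f^n(0) / n approximates the rotation number within 1 / n uniformly. *)
Lemma rot_translate_continuous f :
  homeo_lift f -> continuous (fun l : R => rot (fun x => f x + l)).
Proof.
move=> hf; pose F (l : R) := fun x => f x + l.
have iterc n : continuous (fun l => iter n (F l) 0).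
  elim: n => [|n IHn] l; first exact: cvg_cst.
  apply: (@cvgD _ _ _ _ _ (fun l => f (iter n (F l) 0)) id); last exact: cvg_id.
  apply: (@continuous_comp _ _ _ (fun l => iter n (F l) 0) f); first exact: IHn.
  by case: hf => fc _ _ _; exact: fc.
move=> l; apply/cvgrPdist_le => e e0.
pose n := (Num.truncn (4 / e)).+1.
have ne : 4 < n%:R * e by rewrite -ltr_pdivrMr// truncnS_gt.
have e20 : 0 < n%:R * e / 2 by rewrite !mulr_gt0// ?invr_gt0// ltr0n.
have := iterc n l => /cvgrPdist_le/(_ _ e20); apply: filterS => k.
have := rot_close n (homeo_lift_translate l hf).
have := rot_close n (homeo_lift_translate k hf).
rewrite -/(F l) -/(F k) !ler_norml => /andP[h1 h2] /andP[h3 h4] /andP[h5 h6].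
have n0 : (0 : R) < n%:R by rewrite ltr0n.
by apply/andP; split; rewrite -(ler_pM2l n0); lra.
Qed.

(** Translation by 1 adds 1 to the rotation number, so the intermediate value
    theorem applies. *)
Lemma rot_translate_surj f (t : R) : homeo_lift f -> rot f <= t <= rot f + 1 ->
  exists2 l : R, 0 <= l & rot (fun x => f x + l) = t.
Proof.
move=> hf tP; pose F (l : R) := fun x => f x + l.
have F0 : F 0 = f by apply/funext => x; rewrite /F addr0.
have F1 : rot (F 1) = rot f + 1.
  apply: (@rot_unique _ _ 1); first exact: homeo_lift_translate.
  move=> n; have -> : iter n (F 1) 0 = iter n f 0 + n%:R.
    elim: n => [|n IHn]; first by rewrite addr0.
    by rewrite /= IHn /F (shift_nat (homeo_lift1 hf)) -natr1 addrA.
  have := rot_close n hf; rewrite !ler_norml => /andP[h1 h2].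
  by apply/andP; split; lra.
have [] := @IVT R (fun l => rot (F l)) 0 1 t => //.
- exact/continuous_subspaceT/rot_translate_continuous.
- by rewrite F0 F1 ge_min le_max; case/andP: tP => -> ->; rewrite orbT.
- by move=> l; rewrite in_itv /= => /andP[l0 _] <-; exists l.
Qed.

End RotationNumber.

(** * Positive words and their runs *)

Section Words.
Variable R : realType.
Implicit Types (f g : R -> R) (x y z : R) (w : word) (beta : nat -> nat).

Lemma word_map_le f g w x : homeo_lift f -> (forall y, g y <= y + 1) ->
  word_map f g w x <= iter (h_a w) f x + (h_b w)%:R.
Proof.
move=> hf g_le; rewrite /h_a /h_b; elim: w => [|[] w IHw] /=.
- by rewrite addr0.
- by have := homeo_lift_le hf IHw; rewrite (shift_nat (homeo_lift1 hf)).
- by apply: le_trans (g_le _) _; rewrite natrD; move: IHw; lra.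
Qed.

Lemma rot_lt1 g : homeo_lift g -> rot g < 1 -> forall y, g y < y + 1.
Proof.
move=> hg g1 y; rewrite ltNge; apply/negP => gy.
by have := @rot_ge _ g 1 1 y hg isT gy; rewrite divr1 leNgt g1.
Qed.

(** When rot g < 1 the map g lies below the translation by 1, and replacing g
    by that translation turns the word into f^(h_a) + h_b. *)
Lemma rot_word_le f g w : homeo_lift f -> homeo_lift g -> rot g < 1 ->
  rot (word_map f g w) <= (h_a w)%:R * rot f + (h_b w)%:R.
Proof.
move=> hf hg g1; have g_lt := rot_lt1 hg g1.
have hw := homeo_lift_word w hf hg.
have iter_word n :
    iter n (word_map f g w) 0 <= iter (n * h_a w) f 0 + n%:R * (h_b w)%:R.
  elim: n => [|n IHn]; first by rewrite mul0r addr0.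
  rewrite mulSn iterD; apply: le_trans (homeo_lift_le hw IHn) _.
  apply: le_trans (word_map_le w _ hf (fun y => ltW (g_lt y))) _.
  rewrite -(natrM _ n) (shift_nat (homeo_lift1 (homeo_lift_iter _ hf))).
  by rewrite natrM -natr1 /=; lra.
rewrite -subr_le0; apply: (@archimedean_le0 _ _ 2) => n.
have := rot_close n hw; have := rot_close (n * h_a w) hf; have := iter_word n.
by rewrite !ler_norml natrM => h0 /andP[h1 h2] /andP[h3 h4]; lra.
Qed.

(** The runs of g's have the lengths beta 0, beta 1, and so on, and each run is
    preceded by one f. *)
Fixpoint block_orbit f g beta k z :=
  if k is j.+1 then iter (beta j) g (f (block_orbit f g beta j z)) else z.

Lemma homeo_lift_block_orbit f g beta k : homeo_lift f -> homeo_lift g ->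
  homeo_lift (block_orbit f g beta k).
Proof.
move=> hf hg; elim: k => [|k IHk]; first exact: homeo_lift_id.
exact: (homeo_lift_comp (homeo_lift_iter (beta k) hg) (homeo_lift_comp hf IHk)).
Qed.

Lemma word_map_blocks w : exists s m,
  [/\ size s = h_a w, (sumn s + m)%N = h_b w & forall f g z,
    word_map f g w z = foldr (fun b y => iter b g (f y)) (iter m g z) s].
Proof.
rewrite /h_a /h_b; elim: w => [|[] w [s [m [sz sm sE]]]].
- by exists [::], 0%N.
- exists (0%N :: s), m; split=> /=; rewrite ?sz ?add0n//.
  by move=> f g z; rewrite /= -sE.
- case: s sz sm sE => [|b s] sz sm sE.
  + exists [::], m.+1; split=> //=; first by rewrite -sm.
    by move=> f g z; rewrite /= sE.
  + exists (b.+1 :: s), m; split=> //=; first by rewrite -sm.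
    by move=> f g z; rewrite /= sE.
Qed.

Lemma block_orbit_rev f g beta z (s : seq nat) :
  (forall k, (k < size s)%N -> beta k = nth 0 (rev s) k) ->
  block_orbit f g beta (size s) z = foldr (fun b y => iter b g (f y)) z s.
Proof.
elim: s => [//|b s IHs] betaE /=; rewrite IHs; last first.
  move=> k ks; rewrite betaE ?rev_cons ?nth_rcons ?size_rev ?ks//.
  by rewrite /= ltnS ltnW.
by rewrite betaE// rev_cons nth_rcons size_rev ltnn eqxx.
Qed.

(** The b's applied before the first f can be moved to the end of the word by
    conjugation, so that every letter f is followed by its run of g's. *)
Lemma word_map_conj_blocks w : (0 < h_a w)%N -> exists beta m,
  [/\ forall k, beta (h_a w + k)%N = beta k,
      (\sum_(k < h_a w) beta k)%N = h_b w & forall f g z,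
      iter m g (word_map f g w z) =
      block_orbit f g beta (h_a w) (iter m g z)].
Proof.
have [[|b s] [m [<- <- sE]] // _] := word_map_blocks w.
pose t := (m + b)%N :: s; pose beta k := nth 0%N (rev t) (k %% size t).
exists beta, m; split.
- by move=> k; rewrite /beta modnDl.
- rewrite -[size (b :: s)]/(size t) -(big_mkord xpredT beta) -[size t]size_rev.
  rewrite (eq_big_nat _ _ (F2 := nth 0%N (rev t))); last first.
    by move=> k; rewrite size_rev /beta => kt; rewrite modn_small.
  rewrite -(big_nth 0%N xpredT id) -sumnE sumn_rev /=; lia.
- move=> f g z; rewrite -[size (b :: s)]/(size t) block_orbit_rev.
    by rewrite sE /= iterD.
  by move=> k kt; rewrite /beta modn_small.
Qed.

Lemma block_orbitD f g beta h k z : (forall j, beta (h + j)%N = beta j) ->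
  block_orbit f g beta (h + k) z =
  block_orbit f g beta k (block_orbit f g beta h z).
Proof.
by move=> betah; elim: k => [|k IHk]; rewrite ?addn0// addnS /= IHk betah.
Qed.

Lemma block_orbitM f g beta h n z : (forall j, beta (h + j)%N = beta j) ->
  block_orbit f g beta (n * h) z = iter n (block_orbit f g beta h) z.
Proof.
move=> betah; elim: n z => [//|n IHn] z.
by rewrite mulSn block_orbitD// IHn iterSr.
Qed.

Lemma sum_periodic (F : nat -> nat) h n : (forall k, F (h + k)%N = F k) ->
  (\sum_(i < n * h) F i = n * \sum_(i < h) F i)%N.
Proof.
move=> Fh; elim: n => [|n IHn]; first by rewrite mul0n big_ord0.
rewrite !mulSn big_split_ord /= -IHn; congr (_ + _)%N.
by apply: eq_bigr => i _; rewrite Fh.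
Qed.

End Words.

(** * A lower bound for the rotation number of g *)

Section Necessity.
Variable R : realType.
Implicit Types (f g : R -> R) (x y z : R) (beta L : nat -> nat).

(** When o is periodic under f, this counts, with signs and up to a constant,
    the points below x among the integer translates of the orbit of o.  It is
    constant on each gap between consecutive such points. *)
Definition level f (q : nat) o x : int :=
  \sum_(k < q) Num.floor (x - iter k f o).

Lemma level_le f q o : {homo level f q o : x y / x <= y}.
Proof.
by move=> x y xy; apply: ler_sum => k _; apply: le_floor; rewrite lerD2r.
Qed.

Lemma level_int f q o x (a : int) :
  level f q o (x + a%:~R) = level f q o x + a * q%:Z.
Proof.
rewrite /level; under eq_bigr do rewrite addrAC floorDrz ?intr_int// intrKfloor.
by rewrite big_split /= sumr_const card_ord -mulr_natr natz.
Qed.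

Lemma level_nat f q o x n :
  level f q o (x + n%:R) = level f q o x + n%:Z * q%:Z.
Proof. exact: (level_int f q o x n%:Z). Qed.

(** Applying f to x and to the q orbit points together shifts the index k by
    one; the only change is that the term for f^q(o) = o + p replaces that
    for o. *)
Lemma level_map f q (p : nat) o x : homeo_lift f -> (0 < q)%N ->
  iter q f o = o + p%:R -> level f q o (f x) = level f q o x + p%:Z.
Proof.
case: q => // q hf _ fo.
have step k : Num.floor (f x - iter k.+1 f o) = Num.floor (x - iter k f o).
  apply: floor_def; rewrite lerBrDl ltrBlDl.
  rewrite -!(shift_int (homeo_lift1 hf)) (homeo_lift_mono hf).
  rewrite (leW_mono (homeo_lift_mono hf)) -lerBrDl -ltrBlDl.
  by rewrite floor_le floorD1_gt.
rewrite /level big_ord_recl [in RHS]big_ord_recr /= [LHS]addrC.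
rewrite (eq_bigr (fun k : 'I_q => Num.floor (x - iter k f o))); last first.
  by move=> k _; rewrite -step.
rewrite -addrA; congr (_ + _).
rewrite -step fo opprD addrA -[p%:R]/((p%:Z)%:~R) -mulrNz.
by rewrite (floorDrz (f x - o)) ?intr_int// intrKfloor subrK.
Qed.

Lemma level_lt f q o x y : level f q o x < level f q o y -> x < y.
Proof. by apply: contraTT; rewrite -!leNgt => /level_le. Qed.

Lemma level_iter_le f g q o n x : (forall y, g y < y + 1) ->
  level f q o (iter n g x) <= level f q o x + n%:Z * q%:Z.
Proof.
move=> g_lt; elim: n => [|n IHn]; first by rewrite mul0r addr0.
have := level_le f q o (ltW (g_lt (iter n g x))).
rewrite -[1]/(1%:~R) level_int mul1r (intS n) mulrDl mul1r /=; move: IHn; lia.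
Qed.

(** A letter f raises the level by exactly p and a letter g by at most q.  An
    orbit that advances by the largest conceivable amount leaves no slack, so
    every letter g raises the level by exactly q: up to translation, a run of
    g's stays in one gap of the orbit of f. *)
Lemma periodic_block_levels f g beta h q (p : nat) o z :
  homeo_lift f -> (forall y, g y < y + 1) -> (0 < q)%N -> (0 < h)%N ->
  iter q f o = o + p%:R -> (forall k, beta (h + k)%N = beta k) ->
  iter q (block_orbit f g beta h) z =
    z + (h * p + q * \sum_(k < h) beta k)%:R ->
  (forall y (a : int), block_orbit f g beta h (y + a%:~R) =
    block_orbit f g beta h y + a%:~R) ->
  forall k, level f q o (block_orbit f g beta k z) =
    level f q o z + (p * k + q * \sum_(i < k) beta i)%:Z.
Proof.
move=> hf g_lt q0 h0 fo betah zper Bint.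
pose Z k := block_orbit f g beta k z.
(* The defect of the level: it decreases along the orbit and returns to its
   initial value at every multiple of q h, so it is constant. *)
pose E k : int := level f q o (Z k) - (p * k + q * \sum_(i < k) beta i)%:Z.
have sumM n := sum_periodic n betah.
have E_step k : E k.+1 <= E k.
  rewrite /E /Z /= big_ord_recr /=.
  have := level_iter_le f q o (beta k) (f (Z k)) g_lt.
  rewrite (level_map _ hf q0 fo) -/(Z k); lia.
have E_anti : {homo E : i j / (i <= j)%N >-> j <= i}.
  move=> i j ij; rewrite -(subnKC ij); elim: (j - i)%N => [|d IHd].
    by rewrite addn0.
  by rewrite addnS; exact: le_trans (E_step _) IHd.
have ZM n : Z (n * q * h)%N = z + (n * (h * p + q * \sum_(k < h) beta k))%:R.
  rewrite /Z block_orbitM// iterM; elim: n => [|n IHn]; first by rewrite mul0n addr0.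
  have iterB m y (a : int) : iter m (block_orbit f g beta h) (y + a%:~R) =
     iter m (block_orbit f g beta h) y + a%:~R.
    by elim: m => [//|m IHm] /=; rewrite IHm Bint.
  by rewrite iterS IHn -[X in _ + X]/((Posz _)%:~R) iterB zper -addrA -natrD -mulSn.
have E0 : E 0%N = level f q o z by rewrite /E /= big_ord0 !muln0 subr0.
have EM n : E (n * q * h)%N = level f q o z.
  rewrite /E ZM level_nat sumM. lia.
move=> k; suff <- : E k = level f q o z by rewrite /E subrK.
apply/eqP; rewrite eq_le -{1}E0 E_anti//= -(EM k) E_anti//.
by rewrite -mulnA leq_pmulr// muln_gt0 q0.
Qed.

(** Points Y_j sit in the q consecutive gaps of the orbit of f, and g ^ (L j)
    moves Y_j inside its own gap.  Descending through the gaps one after the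
    other shows that g ^ (sum of the L j) loses at most one unit against the
    translation by 1. *)
Lemma rot_ge_of_runs f g beta L h q (p : nat) :
  homeo_lift f -> homeo_lift g -> rot f = p%:R / q%:R -> rot g < 1 ->
  (0 < q)%N -> (0 < h)%N -> (forall k, beta (h + k)%N = beta k) ->
  (forall j, exists2 k, (p * k.+1 = j %[mod q])%N & beta k = L j) ->
  (0 < \sum_(j < q) L j)%N ->
  (exists z, iter q (block_orbit f g beta h) z =
    z + (h * p + q * \sum_(k < h) beta k)%:R) ->
  1 - (\sum_(j < q) L j)%:R^-1 <= rot g.
Proof.
move=> hf hg rotf g1 q0 h0 betah Lrun S0 [z zper].
have g_lt := rot_lt1 hg g1.
have [c0 fo] := rot_rat_periodic hf q0 rotf.
pose J := level f q c0.
have Zlevel := periodic_block_levels hf g_lt q0 h0 fo betah zper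
  (fun y a => shift_int (homeo_lift1 (homeo_lift_block_orbit beta h hf hg)) a y).
have run j : exists y, J y = J z + j%:Z /\
    J (iter (L j) g y) = J z + j%:Z + (L j * q)%:Z.
  have [k kj <-] := Lrun j.
  set y := f (block_orbit f g beta k z).
  pose c := (p * k.+1 + q * \sum_(i < k) beta i)%N.
  have Jy : J y = J z + c%:Z.
    by rewrite /J (level_map _ hf q0 fo) Zlevel /c; lia.
  have Jgy : J (iter (beta k) g y) = J z + c%:Z + (beta k * q)%:Z.
    have := Zlevel k.+1; rewrite /= -/y -/J big_ord_recr /= /c => ->.
    by rewrite mulnDr addnA PoszD addrA [(q * beta k)%N]mulnC.
  have cj : c = j %[mod q] by rewrite /c addnC mulnC modnMDl.
  pose a : int := (j %/ q)%:Z - (c %/ q)%:Z.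
  have ca : c%:Z + a * q%:Z = j%:Z.
    by rewrite /a {1}(divn_eq c q) {2}(divn_eq j q) cj; lia.
  exists (y + a%:~R); rewrite (shift_int (homeo_lift1 (homeo_lift_iter _ hg))).
  by rewrite /J !level_int -/J Jy Jgy; split; lia.
have [Y YP] := choice run.
case: q q0 rotf Lrun S0 fo @J Zlevel zper run YP => // q q0 rotf Lrun S0 fo J
  Zlevel zper run YP.
have descend i : (i <= q)%N -> forall x, J z + i%:Z <= J x ->
    Y q - 1 + (\sum_(j < i) L j)%:R <= iter (\sum_(j < i) L j) g x.
  elim: i => [|i IHi] iq x Jx.
    rewrite !big_ord0 addr0 /=; apply/ltW/(@level_lt f q.+1 c0).
    rewrite -[- 1]/((-1)%:~R) level_int -/J (YP q).1; move: Jx; lia.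
  rewrite big_ord_recr /= iterD.
  pose u := iter (L i) g (Y i) - (L i)%:R.
  have Ju : J z + i%:Z <= J u.
    rewrite /u -[(L i)%:R]/((L i)%:Z%:~R) -mulrNz /J level_int -/J (YP i).2; lia.
  have Yx : Y i <= x.
    by apply/ltW/(@level_lt f q.+1 c0); rewrite -/J (YP i).1; move: Jx; lia.
  have gx := homeo_lift_le (homeo_lift_iter (L i) hg) Yx.
  have hS := homeo_lift_iter (\sum_(j < i) L j) hg.
  apply: le_trans (homeo_lift_le hS gx).
  rewrite -(subrK (L i)%:R (iter (L i) g (Y i))) (shift_nat (homeo_lift1 hS)).
  by rewrite natrD addrA lerD2r; apply: IHi (ltnW iq) _ Ju.
pose S := (\sum_(j < q.+1) L j)%N.
have top : Y q + (S.-1)%:R <= iter S g (Y q).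
  have -> : (S.-1)%:R = S%:R - 1 :> R by rewrite -subn1 natrB.
  rewrite /S big_ord_recr /= iterD.
  pose u := iter (L q) g (Y q) - (L q)%:R.
  have Ju : J z + q%:Z <= J u.
    rewrite /u -[(L q)%:R]/((L q)%:Z%:~R) -mulrNz /J level_int -/J (YP q).2; lia.
  have hS := homeo_lift_iter (\sum_(j < q) L j) hg.
  rewrite -(subrK (L q)%:R (iter (L q) g (Y q))) (shift_nat (homeo_lift1 hS)).
  have := descend q (leqnn q) _ Ju; rewrite -/u natrD; lra.
have := rot_ge hg S0 top.
apply: le_trans; rewrite -/S -subn1 natrB// mulrBl divff ?mul1r//.
by rewrite pnatr_eq0 -lt0n.
Qed.

End Necessity.

(** * Maps built from a map of the unit interval *)

Section UnitExtension.
Variable R : realType.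
Implicit Types (phi : R -> R) (x y u v C : R).

(** The degree-one extension to the line of a map phi of the unit interval. *)
Definition unit_ext phi x : R :=
  (Num.floor x)%:~R + phi (x - (Num.floor x)%:~R).

Lemma unit_ext_int phi x (k : int) :
  unit_ext phi (x + k%:~R) = unit_ext phi x + k%:~R.
Proof.
rewrite /unit_ext floorDrz ?intr_int// intrKfloor intrD.
by rewrite addrAC; congr (_ + phi _ + _); ring.
Qed.

Lemma unit_extE phi u : 0 <= u < 1 -> unit_ext phi u = phi u.
Proof.
by move=> u01; rewrite /unit_ext (floor_def (m := 0)) ?add0r ?subr0.
Qed.

Lemma floor_cases x y : x <= y ->
  Num.floor x = Num.floor y \/ (Num.floor x)%:~R + 1 <= (Num.floor y)%:~R :> R.
Proof.
move=> /le_floor; rewrite le_eqVlt => /orP[/eqP ->|]; first by left.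
by rewrite -lezD1 => h; right; rewrite -[1]/(1%:~R) -intrD ler_int.
Qed.

Lemma frac01 x : 0 <= x - (Num.floor x)%:~R <= 1.
Proof.
have := floor_le x; have := floorD1_gt x; rewrite intrD => h1 h2.
by apply/andP; split; lra.
Qed.

Lemma unit_ext_lipschitz phi C : phi 0 = 0 -> phi 1 = 1 ->
  (forall u v, 0 <= u -> u <= v -> v <= 1 -> 0 <= phi v - phi u <= C * (v - u)) ->
  forall x y, x <= y ->
    0 <= unit_ext phi y - unit_ext phi x <= C * (y - x).
Proof.
move=> phi0 phi1 phiC x y xy; rewrite /unit_ext.
have /andP[] := frac01 x; have /andP[] := frac01 y.
have [->|kl] := floor_cases xy; first last.
  set u := x - (Num.floor x)%:~R; set v := y - (Num.floor y)%:~R.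
  move=> v0 v1 u0 u1.
  have /andP[h1 h2] := phiC u 1 u0 u1 (lexx _).
  have /andP[h3 h4] := phiC 0 v (lexx _) v0 v1.
  have /andP[_ C1] := phiC 0 1 (lexx _) ler01 (lexx _).
  rewrite phi0 phi1 subr0 mulr1 in C1; rewrite phi1 in h1 h2; rewrite phi0 in h3 h4.
  have xu : x = (Num.floor x)%:~R + u by rewrite /u; ring.
  have yv : y = (Num.floor y)%:~R + v by rewrite /v; ring.
  move: kl xu yv; set k := (Num.floor x)%:~R; set l := (Num.floor y)%:~R.
  move=> kl -> ->.
  have : 0 <= (C - 1) * (l - k - 1) by apply: mulr_ge0; lra.
  by move=> h5; apply/andP; split; lra.
move=> v0 v1 u0 u1.
have := phiC (x - (Num.floor y)%:~R) (y - (Num.floor y)%:~R) u0.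
rewrite lerD2r => /(_ xy v1) /andP[h1 h2].
by apply/andP; split; lra.
Qed.

Lemma unit_ext_lt phi : phi 0 = 0 -> phi 1 = 1 ->
  (forall u v, 0 <= u -> u < v -> v <= 1 -> phi u < phi v) ->
  {homo unit_ext phi : x y / x < y}.
Proof.
move=> phi0 phi1 phi_lt x y xy; rewrite /unit_ext.
have phi_le u v : 0 <= u -> u <= v -> v <= 1 -> phi u <= phi v.
  by move=> u0; rewrite le_eqVlt => /predU1P[->//|uv v1]; exact/ltW/phi_lt.
have /andP[] := frac01 x; have /andP[] := frac01 y.
have [->|kl] := floor_cases (ltW xy); move=> v0 v1 u0 u1.
  by rewrite ltrD2l; apply: phi_lt => //; rewrite ltrD2r.
have ux : x - (Num.floor x)%:~R < 1.
  by have := floorD1_gt x; rewrite intrD; lra.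
have h1 := phi_lt _ _ u0 ux (lexx _).
have h2 := phi_le _ _ (lexx _) v0 v1.
by rewrite phi1 in h1; rewrite phi0 in h2; lra.
Qed.

(** A piecewise linear homeomorphism of the unit interval with two pieces,
    which sends e to 1 - e: for small e it pushes almost everything close
    to 1. *)
Definition push e u : R :=
  Num.min ((1 - e) / e * u) (1 - (1 - u) / ((1 - e) / e)).

Lemma push_homeo_lift e : 0 < e < 1 / 2 ->
  exists psi : R -> R, [/\ homeo_lift psi, psi 0 = 0 & psi e = 1 - e].
Proof.
move=> /andP[e0 e1]; pose K := (1 - e) / e.
have K1 : 1 < K by rewrite ltr_pdivlMr//; lra.
have K0 : 0 < K by lra.
have Ki0 : 0 < K^-1 by rewrite invr_gt0.
have Ki1 : K^-1 < 1 by rewrite invf_lt1.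
have push0 : push e 0 = 0.
  by rewrite /push -/K mulr0 subr0 mul1r min_l// subr_ge0 ltW.
have push1 : push e 1 = 1.
  by rewrite /push -/K mulr1 subrr mul0r subr0 min_r// ltW.
have pushe : push e e = 1 - e.
  rewrite /push -/K (_ : K * e = 1 - e); last by rewrite divfK ?gt_eqF.
  rewrite (_ : (1 - e) / K = e) ?minxx// /K invfM invrK mulrA divff ?mul1r//.
  by rewrite gt_eqF//; lra.
have push_lt u v : u < v -> push e u < push e v.
  move=> uv; rewrite /push -/K lt_min !gt_min.
  by apply/andP; split; apply/orP; [left|right]; [rewrite ltr_pM2l|];
    rewrite // ltrD2l ltrN2 ltr_pM2r// ltrD2l ltrN2.
have push_lip u v : 0 <= u -> u <= v -> v <= 1 ->
    0 <= push e v - push e u <= K * (v - u).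
  move=> _ uv _.
  have h : push e u <= push e v.
    by move: uv; rewrite le_eqVlt => /predU1P[->//|/push_lt/ltW].
  have h2 : 0 <= (K - K^-1) * (v - u) by apply: mulr_ge0; lra.
  rewrite subr_ge0 h /= lerBlDr /push -/K.
  case: (leP (K * u) (1 - (1 - u) / K)) => _; rewrite ge_min; apply/orP; [left|right]; lra.
have lip := unit_ext_lipschitz push0 push1 push_lip.
have ext1 x : unit_ext (push e) (x + 1) = unit_ext (push e) x + 1.
  exact: (unit_ext_int _ _ 1).
have [psi' [hpsi _ _ _]] := continuous_homeo_lift
  (unit_ext_lt push0 push1 (fun u v _ uv _ => push_lt u v uv)) ext1
  (lipschitz_continuous lip).
exists (unit_ext (push e)); split => //.
- by rewrite unit_extE ?push0// lexx ltr01.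
- by rewrite unit_extE ?pushe//; apply/andP; split; lra.
Qed.

End UnitExtension.

(** * A piecewise linear interpolation *)

Section Sufficiency.
Variable R : realType.
Implicit Types (f g : R -> R) (x y z : R) (beta L : nat -> nat).

Definition ramp q (u : R) : R := Num.min 1 (q%:R * u).

(** The piecewise linear interpolation of the partial sums of the q-periodic
    sequence L: the extended ramp with index j climbs from one integer to the
    next between j / q and (j + 1) / q modulo 1 and is flat elsewhere. *)
Definition cumul L q x : R :=
  \sum_(j < q) (L j)%:R * unit_ext (ramp q) (x - j%:R / q%:R).

Section Cumul.
Variables (L : nat -> nat) (q : nat).
Hypothesis q0 : (0 < q)%N.
Let qR : (1 : R) <= q%:R. Proof. by rewrite ler1n. Qed.
Let S := (\sum_(j < q) L j)%N.

Lemma ramp0 : ramp q 0 = 0.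
Proof. by rewrite /ramp mulr0 min_r. Qed.

Lemma ramp1 : ramp q 1 = 1.
Proof. by rewrite /ramp mulr1 min_l. Qed.

Lemma ramp_lipschitz u v : 0 <= u -> u <= v -> v <= 1 ->
  0 <= ramp q v - ramp q u <= q%:R * (v - u).
Proof.
move=> _ uv _; have h : q%:R * u <= q%:R * v by rewrite ler_wpM2l.
rewrite /ramp; case: (leP 1 (q%:R * u)); case: (leP 1 (q%:R * v)); move=> h1 h2;
  by apply/andP; split; lra.
Qed.

Lemma ext_ramp_lipschitz x y : x <= y ->
  0 <= unit_ext (ramp q) y - unit_ext (ramp q) x <= q%:R * (y - x).
Proof. exact: unit_ext_lipschitz ramp0 ramp1 ramp_lipschitz _ _. Qed.

Lemma cumul_lipschitz x y : x <= y ->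
  0 <= cumul L q y - cumul L q x <= q%:R * S%:R * (y - x).
Proof.
move=> xy; rewrite /cumul -sumrB /S natr_sum mulr_sumr mulr_suml.
have h (j : nat) : 0 <= unit_ext (ramp q) (y - j%:R / q%:R)
    - unit_ext (ramp q) (x - j%:R / q%:R) <= q%:R * (y - x).
  rewrite (_ : y - x = (y - j%:R / q%:R) - (x - j%:R / q%:R)); last by ring.
  by apply: ext_ramp_lipschitz; rewrite lerD2r.
apply/andP; split.
  by apply: sumr_ge0 => j _; rewrite -mulrBr mulr_ge0//; case/andP: (h j).
apply: ler_sum => j _; rewrite -mulrBr [q%:R * _]mulrC -mulrA ler_wpM2l//.
by case/andP: (h j).
Qed.

Lemma cumul1 x : cumul L q (x + 1) = cumul L q x + S%:R.
Proof.
rewrite /cumul /S natr_sum -big_split /=; apply: eq_bigr => j _.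
by rewrite addrAC (unit_ext_int _ _ 1) mulrDr mulr1.
Qed.

Lemma cumul_near x : `|S%:R * x - cumul L q x| <= S%:R.
Proof.
rewrite /cumul /S natr_sum mulr_suml -sumrB.
apply: le_trans (ler_norm_sum _ _ _) _; apply: ler_sum => j _.
rewrite -mulrBr normrM ger0_norm// ler_piMr//.
have jq : 0 <= (j%:R / q%:R : R) <= 1.
  apply/andP; split; first by rewrite mulr_ge0// invr_ge0.
  by rewrite ler_pdivrMr ?ltr0n// mul1r ler_nat; apply/ltnW/ltn_ord.
rewrite /unit_ext; set y := x - j%:R / q%:R.
have /andP[u0 u1] := frac01 y; set u := y - (Num.floor y)%:~R in u0 u1 *.
have qu : u <= q%:R * u by rewrite ler_peMl.
have -> : (Num.floor y)%:~R = y - u by rewrite /u; ring.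
case/andP: jq => jq0 jq1; rewrite /ramp /y.
by case: (leP 1 (q%:R * u)) => h; rewrite ler_norml; apply/andP; split; lra.
Qed.

Lemma ext_ramp_int (k : int) :
  exists n : int, unit_ext (ramp q) (k%:~R / q%:R) = n%:~R.
Proof.
rewrite /unit_ext; set l := Num.floor _; rewrite /ramp mulrBr mulrCA divff; last first.
  by rewrite pnatr_eq0 -lt0n.
case: leP => _; [exists (l + 1)|exists (l + (k - q%:Z * l))].
  by rewrite intrD.
by rewrite intrD intrB intrM mulr1.
Qed.

Lemma cumul_int (i : nat) : exists n : int, cumul L q (i%:R / q%:R) = n%:~R.
Proof.
rewrite /cumul; elim/big_ind: _ => [|x y [n ->] [m ->]|j _].
- by exists 0.
- by exists (n + m); rewrite intrD.
- have [n nE] := ext_ramp_int (i%:Z - j%:Z); exists ((L j)%:Z * n).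
  by rewrite -mulrBl -[i%:R - _](intrB _ i%:Z j%:Z) nE intrM.
Qed.

Lemma cumul_step (i : nat) :
  cumul L q (i%:R / q%:R) + (L (i %% q))%:R <= cumul L q (i.+1%:R / q%:R).
Proof.
have q0R : q%:R != 0 :> R by rewrite pnatr_eq0 -lt0n.
have iq : (i %% q < q)%N by rewrite ltn_mod.
rewrite addrC -lerBrDr /cumul -sumrB (bigD1 (Ordinal iq)) //= -mulrBr.
have -> : unit_ext (ramp q) (i.+1%:R / q%:R - (i %% q)%:R / q%:R)
    - unit_ext (ramp q) (i%:R / q%:R - (i %% q)%:R / q%:R) = 1.
  have e : i%:R / q%:R = (i %/ q)%:Z%:~R + (i %% q)%:R / q%:R :> R.
    by rewrite {1}(divn_eq i q) natrD natrM mulrDl mulfK.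
  have -> : i%:R / q%:R - (i %% q)%:R / q%:R = 0 + (i %/ q)%:Z%:~R :> R.
    by rewrite e; ring.
  have -> : i.+1%:R / q%:R - (i %% q)%:R / q%:R = q%:R^-1 + (i %/ q)%:Z%:~R :> R.
    by rewrite -natr1 mulrDl e; ring.
  rewrite !unit_ext_int [unit_ext _ 0]unit_extE ?lexx ?ltr01// ramp0.
  suff -> : unit_ext (ramp q) q%:R^-1 = 1 by ring.
  have [q1|q1] := eqVneq q 1%N.
    rewrite q1 invr1 -[X in unit_ext _ X]add0r (unit_ext_int _ _ 1) unit_extE ?lexx ?ltr01//.
    by rewrite /ramp mulr0 min_r ?add0r.
  rewrite unit_extE; first by rewrite /ramp divff// minxx.
  by rewrite invr_ge0 ler0n invf_lt1 ?ltr0n// ltr1n; lia.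
rewrite mulr1 lerDl; apply: sumr_ge0 => j _; rewrite -mulrBr mulr_ge0//.
have /ext_ramp_lipschitz/andP[] // : i%:R / q%:R - j%:R / q%:R <= i.+1%:R / q%:R - j%:R / q%:R :> R.
by rewrite lerD2r ler_wpM2r ?invr_ge0// ler_nat.
Qed.

End Cumul.

Lemma homeo_lift_rescale psi n (c d : R) : homeo_lift psi -> (0 < n)%N ->
  homeo_lift (fun x => (psi (n%:R * x + c) + d) / n%:R).
Proof.
move=> hpsi n0; have [_ [psi' [_ psiK psi'K]] psi_lt psi1] := hpsi.
have nR : (0 : R) < n%:R by rewrite ltr0n.
have nN := lt0r_neq0 nR.
have [] // := @homeo_lift_bij R (fun x => (psi (n%:R * x + c) + d) / n%:R)
  (fun y => (psi' (n%:R * y - d) - c) / n%:R).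
- move=> x y xy; rewrite ltr_pM2r ?invr_gt0// ltrD2r; apply: psi_lt.
  by rewrite ltrD2r ltr_pM2l.
- move=> x; rewrite mulrDr mulr1 addrAC (shift_nat psi1) addrAC mulrDl.
  by rewrite divff.
- by move=> x; rewrite [n%:R * (_ / _)]mulrC divfK// addrK psiK addrK mulrC mulKf.
- by move=> y; rewrite [n%:R * (_ / _)]mulrC divfK// subrK psi'K subrK mulrC mulKf.
Qed.

End Sufficiency.

(** * An extremal pair of homeomorphisms *)

Section ExtremalPair.
Variable R : realType.
Implicit Types (f g : R -> R) (x y z : R) (beta L : nat -> nat).

Lemma block_orbit_le f g g' beta k z : homeo_lift f -> homeo_lift g' ->
  (forall y, g y <= g' y) ->
  block_orbit f g beta k z <= block_orbit f g' beta k z.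
Proof.
move=> hf hg' gg'.
have iter_le_g n y y' : y <= y' -> iter n g y <= iter n g' y'.
  move=> yy'; elim: n => [//|n IHn].
  exact: le_trans (gg' _) (homeo_lift_le hg' IHn).
elim: k => [//|k IHk] /=; apply: iter_le_g; exact: homeo_lift_le.
Qed.

Section Construction.
Variables (L : nat -> nat) (q p : nat).
Let S := (\sum_(j < q) L j)%N.
Hypotheses (q0 : (0 < q)%N) (S0 : (0 < S)%N).

Let SR : (1 : R) <= S%:R. Proof. by rewrite ler1n. Qed.
Let SN : S%:R != 0 :> R. Proof. by rewrite pnatr_eq0 -lt0n. Qed.
Let qR : (0 : R) < q%:R. Proof. by rewrite ltr0n. Qed.
Let qN : q%:R != 0 :> R. Proof. by rewrite pnatr_eq0 -lt0n. Qed.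
Let e : R := 1 / 8 / S%:R.

Let Se : S%:R * e = 1 / 8. Proof. by rewrite mulrC divfK. Qed.
Let e0 : 0 < e. Proof. by rewrite !divr_gt0 ?ltr0n. Qed.
Let e1 : e <= 1 / 8.
Proof. by rewrite -Se ler_peMl// ltW. Qed.

(** The gap between j / q and (j + 1) / q of the rigid rotation is stretched to
    length about L j / S; the small linear term keeps the map injective when
    L j = 0. *)
Let A x : R := e * x + (1 - e) / S%:R * cumul L q x.

Let S_A x : S%:R * A x = cumul L q x + e * (S%:R * x - cumul L q x).
Proof.
rewrite /A; have := SN; move: (S%:R) => s sN; field.
by [].
Qed.

Let S_A_near x : `|S%:R * A x - cumul L q x| <= 1 / 8.
Proof.
rewrite S_A addrAC subrr add0r normrM (ger0_norm (ltW e0)) -Se mulrC.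
by rewrite ler_wpM2r ?(ltW e0)//; exact: cumul_near.
Qed.

Let e_le1 : 0 <= (1 - e) / S%:R.
Proof. by apply: divr_ge0 => //; move: e1; lra. Qed.

Let A_lt : {homo A : x y / x < y}.
Proof.
move=> x y xy; rewrite /A; apply: ltr_leD; first by rewrite ltr_pM2l.
apply: ler_wpM2l => //.
by have /andP[] := cumul_lipschitz L q0 (ltW xy); rewrite subr_ge0.
Qed.

Let A1 x : A (x + 1) = A x + 1.
Proof. by rewrite /A cumul1 !mulrDr -/S mulr1 divfK//; ring. Qed.

Let A_continuous : continuous A.
Proof.
apply: (lipschitz_continuous (C := e + (1 - e) / S%:R * (q%:R * S%:R))).
move=> x y xy; have /andP[h1 h2] := cumul_lipschitz L q0 xy.
have -> : A y - A x = e * (y - x) + (1 - e) / S%:R * (cumul L q y - cumul L q x).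
  by rewrite /A; ring.
apply/andP; split.
  apply: addr_ge0; apply: mulr_ge0 => //; first exact: ltW.
  by rewrite subr_ge0.
by rewrite [leRHS]mulrDl lerD2l -[leRHS]mulrA ler_wpM2l.
Qed.

(** The map f is the rotation by p / q combined with a push towards the upper
    ends of the gaps, transported by A; the map g is the rotation by 1 - 1 / S
    combined with a push towards the upper ends of the intervals of length
    1 / S whose end points form a periodic orbit of g.  These end points are
    placed so that the gap number j of f contains L j of them: a point close to
    the top of that gap stays in it, relative to the translation by 1, for L j
    applications of g, and f then brings it close to the top of another gap. *)
Lemma extremal_pair : exists f g z,
  [/\ homeo_lift f, homeo_lift g, rot f = p%:R / q%:R,
      rot g = 1 - S%:R^-1 &
      forall beta, (forall k, (beta k <= L ((p * k.+1) %% q))%N) ->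
      forall k c, (p * k = c * q)%N ->
        z + (c + \sum_(i < k) beta i)%:R <= block_orbit f g beta k z].
Proof.
have [A' [hA hA' AK A'K]] := continuous_homeo_lift A_lt A1 A_continuous.
have e_lt : 0 < e < 1 / 2 by rewrite e0 /=; move: e1; lra.
have [psi [hpsi psi0 psie]] := push_homeo_lift e_lt.
have [om [hom om0 ome]] : exists om : R -> R,
    [/\ homeo_lift om, om 0 = 0 & om (1 / 4) = 1 - 1 / 4].
  by apply: push_homeo_lift; apply/andP; split; lra.
pose F x := (psi (q%:R * x + 0) + p%:R) / q%:R.
pose f := A \o F \o A'.
pose g x := (om (S%:R * x + 1 / 2) + (S%:R - 1 - 1 / 2)) / S%:R.
have hF : homeo_lift F by exact: homeo_lift_rescale.
have hf : homeo_lift f by exact: (homeo_lift_comp (homeo_lift_comp hA hF) hA').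
have hg : homeo_lift g by exact: (homeo_lift_rescale _ _ hom S0).
have fA x : f (A x) = A (F x) by rewrite /f /= AK.
pose X x := S%:R * x + 1 / 2.
have Xg x : X (g x) = om (X x) + (S%:R - 1).
  by rewrite /X /g mulrC divfK//; lra.
have X_le : {mono X : x y / x <= y}.
  by move=> x y; rewrite /X lerD2r ler_pM2l// ltr0n.
have X_inj : injective X by exact: (inc_inj X_le).
exists f, g, (A (e / q%:R)); split=> //.
- apply: (rot_periodic (x := A 0)) => //.
  have fk k : iter k f (A 0) = A ((p * k)%:R / q%:R).
    elim: k => [|k IHk]; first by rewrite muln0 mul0r.
    rewrite iterS IHk fA /F addr0 [q%:R * (_ / _)]mulrC divfK// -[(p * k)%:R]add0r.
    by rewrite (shift_nat (homeo_lift1 hpsi)) psi0 add0r mulnS addnC natrD.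
  by rewrite fk natrM mulfK// -[p%:R]add0r (shift_nat (homeo_lift1 hA)) add0r.
- have S1 : (S.-1)%:R = S%:R - 1 :> R by rewrite -subn1 natrB.
  rewrite (rot_periodic (x := - (1 / 2) / S%:R) (N := S.-1) hg S0).
    by rewrite S1 mulrBl divff// mul1r.
  have gk k : X (iter k g (- (1 / 2) / S%:R)) = (k * S.-1)%:R.
    elim: k => [|k IHk]; first by rewrite /X mulrC divfK// addNr.
    rewrite iterS Xg IHk -[(k * _)%:R]add0r (shift_nat (homeo_lift1 hom)) om0.
    by rewrite add0r mulSn addnC natrD S1.
  by apply: X_inj; rewrite gk /X mulrDr (mulrC _ (_ / _)) divfK// natrM; lra.
(* A point whose X-coordinate is above n + 1/4 stays above n + 3/4 after
   any positive number of steps, in the frame moving by S - 1 per step. *)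
have g_push (n : int) x m : n%:~R + 1 / 4 <= X x ->
    n%:~R + m.+1%:R * (S%:R - 1) + 3 / 4 <= X (iter m.+1 g x).
  have S1 : S%:R - 1 = (S.-1)%:R :> R by rewrite -subn1 natrB.
  move=> nX.
  have step y (l : int) : l%:~R + 1 / 4 <= X y ->
      l%:~R + (S%:R - 1) + 3 / 4 <= X (g y).
    move=> lX; have := homeo_lift_le hom lX.
    by rewrite addrC (shift_int (homeo_lift1 hom)) ome Xg; lra.
  elim: m => [|m IHm]; first by have := step _ _ nX; rewrite /=; lra.
  rewrite iterS.
  have := step (iter m.+1 g x) (n + (m.+1 * S.-1)%N%:Z).
  rewrite intrD -[((m.+1 * S.-1)%N%:Z)%:~R]/((m.+1 * S.-1)%:R) natrM -S1.
  by rewrite -[m.+2%:R]natr1; move: IHm; lra.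
have qSe : q%:R * S%:R * (e / q%:R) = 1 / 8.
  by rewrite -Se; have := qN; move: (q%:R) (S%:R) => a b aN; field.
(* In units of 1 / S the bottom of gap j lies below N + 3/4 and its top above
   N' + 1/4, with N + L j <= N', so m <= L j steps down stay in the gap. *)
have g_run j m : (m <= L (j %% q))%N ->
    A ((j%:R + e) / q%:R) + m%:R <= iter m g (A ((j.+1%:R - e) / q%:R)).
  move=> mL; rewrite -X_le.
  have [N NE] := cumul_int R L q0 j; have [N' N'E] := cumul_int R L q0 j.+1.
  have NN' := cumul_step R L q0 j; rewrite NE N'E in NN'.
  have bot : X (A ((j%:R + e) / q%:R)) <= N%:~R + 3 / 4.
    have je : j%:R / q%:R <= (j%:R + e) / q%:R.
      by rewrite ler_wpM2r ?invr_ge0 ?(ltW qR)// lerDl ltW.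
    have /andP[_] := cumul_lipschitz L q0 je.
    rewrite -mulrBl addrAC subrr add0r => h.
    have := S_A_near ((j%:R + e) / q%:R); move: h.
    rewrite NE -/S qSe.
    by rewrite /X ler_norml => h /andP[_ h2]; lra.
  have top : N'%:~R + 1 / 4 <= X (A ((j.+1%:R - e) / q%:R)).
    have je : (j.+1%:R - e) / q%:R <= j.+1%:R / q%:R.
      by rewrite ler_wpM2r ?invr_ge0 ?(ltW qR)// gerBl ltW.
    have /andP[_] := cumul_lipschitz L q0 je.
    rewrite -[X in _ <= _ * X]mulrBl opprB addrCA subrr addr0 => h.
    have := S_A_near ((j.+1%:R - e) / q%:R); move: h.
    rewrite N'E -/S qSe.
    by rewrite /X ler_norml => h /andP[h2 _]; lra.
  case: m mL => [_|m mL].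
    rewrite addr0 X_le (homeo_lift_mono hA) ler_wpM2r ?invr_ge0 ?(ltW qR)//.
    by rewrite -natr1; move: e1; lra.
  have := g_push _ _ m top; apply: le_trans.
  have -> : X (A ((j%:R + e) / q%:R) + m.+1%:R)
      = X (A ((j%:R + e) / q%:R)) + m.+1%:R * S%:R by rewrite /X; ring.
  have : m.+1%:R <= (L (j %% q))%:R :> R by rewrite ler_nat.
  by move: bot NN'; lra.
move=> beta betaL.
have orbit k : A (((p * k)%:R + e) / q%:R) + (\sum_(i < k) beta i)%:R <=
    block_orbit f g beta k (A (e / q%:R)).
  elim: k => [|k IHk]; first by rewrite muln0 add0r big_ord0 addr0.
  have := homeo_lift_le hf IHk.
  rewrite (shift_nat (homeo_lift1 hf)) fA /F addr0.
  rewrite [q%:R * (_ / _)]mulrC divfK// addrC [_ + e]addrC.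
  rewrite (shift_nat (homeo_lift1 hpsi)) psie.
  have -> : 1 - e + (p * k)%:R + p%:R = (p * k.+1).+1%:R - e.
    by rewrite mulnS -natr1 natrD; ring.
  move=> /(homeo_lift_le (homeo_lift_iter (beta k) hg)).
  apply: le_trans; rewrite addrC (shift_nat (homeo_lift1 (homeo_lift_iter _ hg))).
  rewrite big_ord_recr /= natrD addrA addrAC lerD2r.
  exact: g_run.
move=> k c pk; have := orbit k; rewrite pk natrM mulrDl mulfK//.
by rewrite addrC [c%:R + _]addrC (shift_nat (homeo_lift1 hA)) natrD; lra.
Qed.

End Construction.
End ExtremalPair.

(** * Sums of longest runs *)

Section RunMax.
Local Open Scope nat_scope.
Implicit Types (beta : nat -> nat) (h p q k v n : nat).

(** The longest run of b's met in the gap visited after k letters a: that gap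
    is visited again after every q further letters. *)
Definition run_max beta h q k : nat := \max_(v < h) beta (k + v * q)%N.

Definition run_sum beta h q : nat := \sum_(k < q) run_max beta h q k.

Section Periodic.
Variables (beta : nat -> nat) (h : nat).
Hypotheses (h0 : (0 < h)%N) (betah : forall k, beta (h + k)%N = beta k).

Lemma beta_mod k : beta (k %% h) = beta k.
Proof.
rewrite [in RHS](divn_eq k h); elim: (k %/ h)%N => [//|n IHn].
by rewrite mulSn -addnA betah.
Qed.

Lemma run_max_ge q k v : (beta (k + v * q) <= run_max beta h q k)%N.
Proof.
rewrite -beta_mod -modnDmr -modnMml modnDmr beta_mod.
exact: (leq_bigmax (Ordinal (ltn_pmod v h0))).
Qed.

Lemma run_max_attained q k : exists v, beta (k + v * q) = run_max beta h q k.
Proof.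
have [|v vE] := @bigop.eq_bigmax _ (fun v : 'I_h => beta (k + v * q)%N).
  by rewrite card_ord.
by exists v; rewrite /run_max vE.
Qed.

Lemma run_maxD q k : run_max beta h q (q + k) = run_max beta h q k.
Proof.
apply/eqP; rewrite eqn_leq; apply/andP; split.
- have [v <-] := run_max_attained q (q + k).
  by rewrite addnAC -mulSn addnC run_max_ge.
- have [v <-] := run_max_attained q k.
  rewrite -beta_mod -(modnMDl q) beta_mod.
  have -> : (q * h + (k + v * q) = q + k + (v + h.-1) * q)%N.
    by case: h h0 => // h' _; rewrite /=; ring.
  exact: run_max_ge.
Qed.

Lemma run_max_mod q k : run_max beta h q (k %% q) = run_max beta h q k.
Proof.
rewrite [in RHS](divn_eq k q); elim: (k %/ q)%N => [//|n IHn].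
by rewrite mulSn -addnA run_maxD.
Qed.

Lemma run_sum_gt0 q : (0 < q)%N -> (0 < \sum_(k < h) beta k)%N ->
  (0 < run_sum beta h q)%N.
Proof.
move=> q0; apply: contraTT; rewrite -!leqNgt !leqn0 !sum_nat_eq0.
move=> /forallP S0; apply/forallP => k; apply/implyP => _.
rewrite -leqn0; have := run_max_ge q k 0; rewrite addn0.
rewrite -(run_max_mod q k); have := S0 (Ordinal (ltn_pmod k q0)).
by move=> /= /eqP ->.
Qed.

(** Modulo h the sequence beta, and hence the maximum over a residue class
    modulo q, only sees q modulo h; so both sums average the same function. *)
Lemma run_sum_congr q q' : q = q' %[mod h] ->
  (q' * run_sum beta h q = q * run_sum beta h q')%N.
Proof.
move=> qq'.
have maxE k : run_max beta h q k = run_max beta h q' k.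
  apply: eq_bigr => v _; rewrite -beta_mod -modnDmr -modnMmr qq'.
  by rewrite modnMmr modnDmr beta_mod.
rewrite /run_sum -(sum_periodic q' (run_maxD q)) -(sum_periodic q (run_maxD q')).
by rewrite mulnC; apply: eq_bigr => k _; rewrite maxE.
Qed.

(** After k letters a the orbit of a word lies in the gap p k modulo q; the
    bijection k |-> p k turns runs counted by time into runs counted by place. *)
Lemma gap_runs p q : (0 < q)%N -> (0 < p)%N -> coprime p q -> exists L,
  [/\ forall k, (beta k <= L ((p * k.+1) %% q))%N,
      forall j, exists2 k, p * k.+1 = j %[mod q] & beta k = L j &
      (\sum_(j < q) L j)%N = run_sum beta h q].
Proof.
move=> q0 p0 pq.
have [p' [c pp']] : exists p' c, (p' * p = c * q + 1)%N.
  case: (egcdnP q p0) => p' c + _; rewrite (eqP pq) => e; by exists p', c.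
pose time j := (p' * j + q.-1)%N.
have timeE j : (p * (time j).+1 = (c * j + p) * q + j)%N.
  rewrite /time -addnS prednK// mulnDr mulnA [(p * p')%N]mulnC pp'; ring.
exists (fun j => run_max beta h q (time j)); split.
- move=> k; have -> : run_max beta h q (time ((p * k.+1) %% q)) = run_max beta h q k.
    rewrite -(run_max_mod q (time _)) -[RHS]run_max_mod; congr run_max.
    rewrite /time -modnDml modnMmr modnDml mulnA pp'.
    have -> : ((c * q + 1) * k.+1 + q.-1 = (c * k.+1 + 1) * q + k)%N.
      by case: q q0 {pq pp' timeE time} => // q' _; rewrite /=; ring.
    by rewrite modnMDl.
  by have := run_max_ge q k 0; rewrite addn0.
- move=> j; have [v vE] := run_max_attained q (time j).
  exists (time j + v * q)%N => //.
  by rewrite -addSn mulnDr timeE mulnA addnC modnMDl modnMDl.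
- have t_inj : injective (fun j : 'I_q => Ordinal (ltn_pmod (time j) q0)).
    move=> i j /(congr1 val) /= ij; apply/val_inj => /=.
    rewrite -[LHS](modn_small (ltn_ord i)) -[RHS](modn_small (ltn_ord j)).
    have modE (l : nat) : l = p * (time l).+1 %[mod q].
      by rewrite timeE modnMDl.
    have modS l : ((time l).+1 %% q = (time l %% q + 1) %% q).
      by rewrite modnDml addn1.
    rewrite (modE i) (modE j) -(modnMmr p (time i).+1) -(modnMmr p (time j).+1).
    by rewrite !modS ij.
  rewrite /run_sum [RHS](reindex_inj t_inj) /=.
  by apply: eq_bigr => j _; rewrite run_max_mod.
Qed.

End Periodic.
End RunMax.

(** * The fringe length at a rational point *)

Section FringeFormula.
Variable R : realType.
Implicit Types (f g : R -> R) (w : word) (beta : nat -> nat).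

Lemma semiconj_iter (T : Type) (c u v : T -> T) n x :
  (forall y, c (u y) = v (c y)) -> c (iter n u x) = iter n v (c x).
Proof. by move=> cuv; elim: n => [//|n IHn]; rewrite !iterS cuv IHn. Qed.

(** The maximum equals the trivial upper bound exactly when that bound is
    attained, which the bound being nonzero distinguishes from the default. *)
Lemma max_rot_eq w (r t : R) : t < 1 -> (h_a w)%:R * r + (h_b w)%:R != 0 ->
  max_rot w r t = (h_a w)%:R * r + (h_b w)%:R <->
  exists f g, [/\ homeo_lift f, homeo_lift g, rot f = r, rot g = t &
    (h_a w)%:R * r + (h_b w)%:R <= rot (word_map f g w)].
Proof.
set N := _ + _ => t1 N0.
have ubN : ubound (rot_values w r t) N.
  move=> _ [f [g [hf hg fr gt ->]]]; rewrite /N -fr; apply: rot_word_le => //.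
  by rewrite gt.
rewrite /max_rot; split.
- case: xgetP => [x _ [[f [g [hf hg fr gt ->]]] _] NE|_ /eqP]; last first.
    by rewrite eq_sym (negbTE N0).
  by exists f, g; split; rewrite // NE.
- move=> [f [g [hf hg fr gt Nle]]].
  have NE : N = rot (word_map f g w).
    by apply/eqP; rewrite eq_le Nle; apply: ubN; exists f, g.
  apply: xget_unique; first by split => //; exists f, g; split.
  move=> x [xv xub]; apply/eqP; rewrite eq_le ubN//=; apply: xub.
  by exists f, g; split.
Qed.

Section Blocks.
Variables (w : word) (beta : nat -> nat) (m : nat).
Hypotheses (ha0 : (0 < h_a w)%N) (hb0 : (0 < h_b w)%N).
Hypothesis betah : forall k, beta (h_a w + k)%N = beta k.
Hypothesis sum_beta : (\sum_(k < h_a w) beta k)%N = h_b w.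
Hypothesis conj_blocks : forall (f g : R -> R) z,
  iter m g (word_map f g w z) = block_orbit f g beta (h_a w) (iter m g z).

(** Necessity is [rot_ge_of_runs] applied to a periodic orbit of the word.  For
    sufficiency, the second map of [extremal_pair] is moved up by a translation
    until its rotation number is t, which only speeds up the word. *)
Lemma max_rot_rat p q (t : R) : (0 < q)%N -> (0 < p)%N -> coprime p q ->
  0 <= t < 1 ->
  (max_rot w (p%:R / q%:R) t = (h_a w)%:R * (p%:R / q%:R) + (h_b w)%:R <->
   1 - (run_sum beta (h_a w) q)%:R^-1 <= t).
Proof.
move=> q0 p0 pq /andP[t0 t1].
have qN : q%:R != 0 :> R by rewrite pnatr_eq0 -lt0n.
have S0 : (0 < run_sum beta (h_a w) q)%N by rewrite run_sum_gt0// sum_beta.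
have [L [betaL Lbeta SL]] := gap_runs ha0 betah q0 p0 pq.
have NE : (h_a w)%:R * (p%:R / q%:R) + (h_b w)%:R
    = (h_a w * p + q * h_b w)%:R / q%:R :> R.
  by rewrite natrD !natrM; field.
have N0 : (h_a w)%:R * (p%:R / q%:R) + (h_b w)%:R != 0 :> R.
  by rewrite NE mulf_neq0 ?invr_eq0// pnatr_eq0 -lt0n addn_gt0 !muln_gt0 ha0 p0.
rewrite max_rot_eq// NE; split.
- move=> [f [g [hf hg fr gt Nle]]].
  have hw := homeo_lift_word w hf hg.
  have wr : rot (word_map f g w) = (h_a w * p + q * h_b w)%:R / q%:R.
    apply/eqP; rewrite eq_le Nle andbT -NE -fr.
    by apply: rot_word_le => //; rewrite gt.
  have [x wx] := rot_rat_periodic hw q0 wr.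
  rewrite -gt -SL; apply: (rot_ge_of_runs hf hg fr _ q0 ha0 betah Lbeta).
  + by rewrite gt.
  + by rewrite SL.
  + exists (iter m g x); rewrite -(semiconj_iter _ _ (conj_blocks f g)) wx.
    by rewrite (shift_nat (homeo_lift1 (homeo_lift_iter m hg))) sum_beta.
- move=> St; rewrite -SL in S0 St.
  have [f [g [z [hf hg fr gr orbit]]]] := @extremal_pair R L q p q0 S0.
  have [|l l0 gt] := @rot_translate_surj _ g t hg.
    rewrite gr St /=; apply: (le_trans (ltW t1)).
    by rewrite lerDr subr_ge0 invf_le1 ?ltr0n// ler1n.
  set g' := fun x => g x + l in gt.
  have hg' : homeo_lift g' by exact: homeo_lift_translate.
  have gg' x : g x <= g' x by rewrite lerDl.
  exists f, g'; split => //.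
  have [u uz] : exists u, iter m g' u = z.
    have [_ [k [_ _ kK]] _ _] := homeo_lift_iter m hg'.
    by exists (k z).
  apply: (rot_ge (x := u)) => //; first exact: homeo_lift_word.
  have hm := homeo_lift_iter m hg'.
  rewrite -(homeo_lift_mono hm) (shift_nat (homeo_lift1 hm)).
  rewrite (semiconj_iter _ _ (conj_blocks f g')) -block_orbitM// uz.
  apply: le_trans (block_orbit_le beta _ z hf hg' gg').
  have := orbit beta betaL (q * h_a w)%N (h_a w * p)%N.
  rewrite (sum_periodic _ betah) sum_beta; apply; ring.
Qed.

Lemma fringe_length_rat p q : (0 < q)%N -> (0 < p)%N -> coprime p q ->
  fringe_length R w (p%:R / q%:R) = (run_sum beta (h_a w) q)%:R^-1.
Proof.
move=> q0 p0 pq; set r : rat := _ / _; set S := run_sum _ _ _.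
have S0 : (0 < S)%N by rewrite run_sum_gt0// sum_beta.
have Si : 0 < (S%:R^-1 : rat) <= 1.
  by rewrite invr_gt0 ltr0n S0 invf_le1 ?ltr0n// ler1n.
have rE : ratr r = p%:R / q%:R :> R by rewrite /r fmorph_div /= !rmorph_nat.
have sE : ratr (1 - S%:R^-1) = 1 - S%:R^-1 :> R.
  by rewrite rmorphB rmorph1 fmorphV rmorph_nat.
suff e : fringe_start R w r = 1 - S%:R^-1 by rewrite /fringe_length e subKr.
have fringe : in_fringe R w r (1 - S%:R^-1).
  split; first by case/andP: Si => S1 S2; apply/andP; split; lra.
  move=> t; rewrite sE rE => /andP[st t1]; rewrite max_rot_rat// t1 andbT.
  apply: le_trans st; rewrite subr_ge0 invf_le1 ?ltr0n//; last by rewrite ler1n.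
have lower : lbound [set s | in_fringe R w r s] (1 - S%:R^-1).
  move=> s [/andP[s0 s1] /(_ (ratr s))].
  rewrite lexx -(ltr_rat R) in s1 *; rewrite rmorph1 in s1; rewrite s1 rE.
  move=> /(_ isT) /max_rot_rat; rewrite -sE ler_rat; apply => //.
  by rewrite s1 ler0q s0.
apply: xget_unique; first by split.
move=> s [sf slb]; apply/eqP; rewrite eq_le; apply/andP; split.
- exact: slb.
- exact: lower.
Qed.

End Blocks.
End FringeFormula.

(** * Moebius transformations *)

Section Moebius.
Implicit Types (x y : rat) (a b c d : int) (w : word).

Lemma numq_denq x : 0 < x ->
  x = `|numq x|%:R / `|denq x|%:R /\ (0 < `|numq x|)%N.
Proof.
move=> x0; have n0 : 0 < numq x by rewrite numq_gt0.
split; last by rewrite absz_gt0 gt_eqF.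
have natE (k : int) : 0 < k -> `|k|%:R = k%:~R :> rat.
  by move=> k0; rewrite -[in RHS](gtz0_abs k0).
by rewrite !natE ?denq_gt0// divq_num_den.
Qed.

(** A matrix of determinant one maps coprime pairs to coprime pairs. *)
Lemma denq_moebius a b c d x : a * d - b * c = 1 ->
  0 < c%:~R * x + d%:~R ->
  denq ((a%:~R * x + b%:~R) / (c%:~R * x + d%:~R)) = c * numq x + d * denq x.
Proof.
move=> det pos; set n := numq x; set e := denq x.
have e0 : (0 : rat) < e%:~R by rewrite ltr0z denq_gt0.
have eN := lt0r_neq0 e0.
have xE : x = n%:~R / e%:~R by rewrite divq_num_den.
have linE k l : k%:~R * x + l%:~R = (k * n + l * e)%:~R / e%:~R :> rat.
  by rewrite intrD !intrM xE; field.
have q0 : 0 < c * n + d * e.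
  by move: pos; rewrite linE pmulr_lgt0 ?invr_gt0// ltr0z.
rewrite !linE invfM invrK mulrACA mulVf// mulr1 coprimeq_den; last first.
  have : coprimez n e by rewrite coprimezE coprime_num_den.
  case/coprimezP => -[u v] /= uv; rewrite -coprimezE; apply/coprimezP.
  exists (u * d - v * c, v * a - u * b) => /=.
  transitivity ((a * d - b * c) * (u * n + v * e)); first by ring.
  by rewrite det uv mulr1.
by rewrite gt_eqF// gtr0_norm.
Qed.

(** Such a transformation multiplies the denominator of x by c x + d and keeps
    its residue modulo h_a, whereas the fringe length times the denominator
    depends on that residue only. *)
Lemma fringe_length_moebius (R : realType) w a b c d x :
  (0 < h_a w)%N -> (0 < h_b w)%N -> a * d - b * c = 1 ->
  ((h_a w)%:Z %| c)%Z -> ((h_a w)%:Z %| d - 1)%Z ->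
  let y := (a%:~R * x + b%:~R) / (c%:~R * x + d%:~R) in
  0 < x -> 0 < c%:~R * x + d%:~R -> 0 < y ->
  fringe_length R w y = fringe_length R w x / (c%:~R * x + d%:~R).
Proof.
move=> ha0 hb0 det hc hd y x0 den0 y0.
have [beta [m [betah sum_beta conj_blocks]]] := word_map_conj_blocks R ha0.
have formula z : 0 < z ->
    fringe_length R w z = (run_sum beta (h_a w) `|denq z|)%:R^-1.
  move=> /numq_denq [zE n0]; rewrite {1}zE.
  apply: (fringe_length_rat ha0 hb0 betah sum_beta conj_blocks) => //.
    by rewrite absz_gt0 gt_eqF// denq_gt0.
  exact: coprime_num_den.
have denE : denq y = c * numq x + d * denq x by exact: denq_moebius.
set q := `|denq x|%N; set q' := `|denq y|%N.
have qE : denq x = q%:Z by rewrite /q gtz0_abs ?denq_gt0.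
have q'E : denq y = q'%:Z by rewrite /q' gtz0_abs ?denq_gt0.
have q0 : (0 < q)%N by rewrite absz_gt0 gt_eqF// denq_gt0.
have q'0 : (0 < q')%N by rewrite absz_gt0 gt_eqF// denq_gt0.
have qq' : q = q' %[mod h_a w].
  suff : (q%:Z == q'%:Z %[mod (h_a w)%:Z])%Z by rewrite !modz_nat => /eqP[].
  rewrite eqz_mod_dvd -qE -q'E denE.
  have -> : denq x - (c * numq x + d * denq x)
      = - (c * numq x) - (d - 1) * denq x by ring.
  by rewrite rpredB ?rpredN ?dvdz_mulr.
have avg : q'%:R * (run_sum beta (h_a w) q)%:R
    = q%:R * (run_sum beta (h_a w) q')%:R :> rat.
  by rewrite -!natrM (run_sum_congr ha0 betah qq').
have runs_gt0 r : (0 < r)%N -> (run_sum beta (h_a w) r)%:R != 0 :> rat.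
  by move=> r0; rewrite pnatr_eq0 -lt0n run_sum_gt0// sum_beta.
have SN := runs_gt0 q q0; have S'N := runs_gt0 q' q'0.
have qN : q%:R != 0 :> rat by rewrite pnatr_eq0 -lt0n.
have q'N : q'%:R != 0 :> rat by rewrite pnatr_eq0 -lt0n.
have -> : c%:~R * x + d%:~R = q'%:R / q%:R.
  have -> : q'%:R = (denq y)%:~R :> rat by rewrite q'E.
  have -> : q%:R = (denq x)%:~R :> rat by rewrite qE.
  rewrite denE intrD !intrM -{1}(divq_num_den x).
  by field; rewrite intr_eq0 denq_neq0.
rewrite !formula// -/q -/q' invf_div.
apply: (mulfI q'N); apply: (mulfI S'N); apply: (mulfI SN).
transitivity (q'%:R * (run_sum beta (h_a w) q)%:R : rat); first by field.
by rewrite avg; field; rewrite q'N.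
Qed.

End Moebius.

(** * The fringe graphs *)

Section GraphBijection.
Variable R : realType.
Implicit Types (w : word) (x y : rat).

Lemma fringe_graph_bij w (I J : set R) (T : R * R -> R * R) (phi psi : rat -> rat) :
  (forall x, I (ratr x) -> J (ratr (phi x)) /\
     T (ratr x, ratr (fringe_length R w x)) =
       (ratr (phi x), ratr (fringe_length R w (phi x)))) ->
  (forall y, J (ratr y) -> I (ratr (psi y)) /\ phi (psi y) = y) ->
  (forall x, I (ratr x) -> psi (phi x) = x) ->
  set_bij (fringe_graph w I) (fringe_graph w J) T.
Proof.
move=> phiP psiP phiK; split.
- by move=> _ [x /phiP[Jx TE] <-]; exists (phi x).
- move=> u v; rewrite !inE => -[x Ix <-] [y Iy <-].
  have [_ ->] := phiP _ Ix; have [_ ->] := phiP _ Iy.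
  by move=> [/fmorph_inj xy _]; rewrite -(phiK _ Ix) xy phiK.
- move=> _ [y Jy <-]; have [Ix yE] := psiP _ Jy.
  exists (ratr (psi y), ratr (fringe_length R w (psi y))); first by exists (psi y).
  by have [_ ->] := phiP _ Ix; rewrite yE.
Qed.

Lemma ratr_itv (a b x : rat) :
  (`]ratr a, ratr b[%classic : set R) (ratr x) = (a < x < b) :> Prop.
Proof. by rewrite /= in_itv /= !ltr_rat. Qed.

End GraphBijection.

Theorem theorem5p2 (R : realType) (w : word)
  (w_not_pow_a : ~ is_power la w) (w_not_pow_b : ~ is_power lb w)
  (h_a_prime : prime (h_a w)) :
  let h : R := (h_a w)%:R in
  set_bij (fringe_graph w `]0, 1 / (h + 1)[) (fringe_graph w `]0, 1[)
    (@T11 R (h_a w)) /\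
  set_bij (fringe_graph w `]1 / (h + 1), 1 / h[) (fringe_graph w `]0, 1 / h[)
    (@T12 R (h_a w)).
Proof.
move=> h; set n := h_a w in h_a_prime h *.
have hb0 : (0 < h_b w)%N.
  rewrite lt0n; apply: contra_notN w_not_pow_a => hb; exists (size w).
  apply/all_pred1P; rewrite all_count -/(h_a w).
  rewrite -(count_predC (fun c : bool => c == la) w) -[X in X == _]addn0 eqn_add2l.
  by rewrite eq_sym -(eqP hb); apply/eqP/eq_count => -[].
have n1 : (1 < n)%N := prime_gt1 h_a_prime.
have n0 : (0 < n)%N := ltnW n1.
pose H : rat := n%:R.
have H1 : 1 < H by rewrite ltr1n.
have hE : h = ratr H by rewrite rmorph_nat.
have zeroE : 0 = ratr 0 :> R by rewrite rmorph0.
have oneE : 1 = ratr 1 :> R by rewrite rmorph1.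
have e1 : 1 / (h + 1) = ratr (1 / (H + 1)) by rewrite hE fmorph_div rmorphD rmorph1.
have e2 : 1 / h = ratr (1 / H) by rewrite hE fmorph_div rmorph1.
have den0 x : 1 < x * (H + 1) -> 0 < H ^+ 2 * x - (H - 1).
  move=> x0; have : 0 < H ^+ 2 * (x * (H + 1) - 1) by rewrite mulr_gt0 ?exprn_gt0; lra.
  move=> num0; have : 0 < (H ^+ 2 * x - (H - 1)) * (H + 1) by lra.
  by rewrite pmulr_lgt0//; lra.
split.
- rewrite e1 {1 2}zeroE oneE.
  apply: (@fringe_graph_bij _ _ _ _ _ (fun x => x / (1 - H * x))
    (fun y => y / (1 + H * y))).
  + move=> x; rewrite !ratr_itv => /andP[x0 x1].
    have d0 : 0 < 1 - H * x.
      by move: x1; rewrite ltr_pdivlMr; lra.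
    split.
      rewrite divr_gt0//= ltr_pdivrMr// mul1r.
      by move: x1; rewrite ltr_pdivlMr; lra.
    have denE : 1 - n%:R * ratr x = ratr (1 - H * x) :> R.
      by rewrite rmorphB rmorph1 rmorphM rmorph_nat.
    rewrite /T11 /= denE -!fmorph_div.
    have := @fringe_length_moebius R w 1 0 (- n%:Z) 1 x n0 hb0.
    have -> : (- n%:Z)%:~R = - H :> rat by rewrite mulrNz.
    rewrite [1%:~R * x]mul1r [_ + 0%:~R]addr0 mulNr [_ + 1%:~R]addrC => ->//.
    * by rewrite mul1r mul0r subr0.
    * by rewrite rpredN dvdzz.
    * by rewrite divr_gt0.
  + move=> y; rewrite !ratr_itv => /andP[y0 y1].
    have d0 : 0 < 1 + H * y by rewrite addr_gt0// mulr_gt0//; lra.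
    split; last by field; apply/andP; split; lra.
    rewrite divr_gt0//= ltr_pdivrMr// mulrAC ltr_pdivlMr; lra.
  + move=> x; rewrite !ratr_itv => /andP[x0 x1].
    have d0 : 0 < 1 - H * x by move: x1; rewrite ltr_pdivlMr; lra.
    field; lra.
- rewrite e1 e2 zeroE.
  apply: (@fringe_graph_bij _ _ _ _ _
    (fun x => ((H + 1) * x - 1) / (H ^+ 2 * x - (H - 1)))
    (fun y => (1 - (H - 1) * y) / (H + 1 - H ^+ 2 * y))).
  + move=> x; rewrite !ratr_itv => /andP[x0 x1].
    rewrite ltr_pdivrMr in x0; last by lra.
    rewrite ltr_pdivlMr in x1; last by lra.
    have d0 := den0 x x0.
    have num0 : 0 < (H + 1) * x - 1 by lra.
    split.
      rewrite divr_gt0//= ltr_pdivrMr// mulrAC mul1r ltr_pdivlMr; last by lra.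
      by lra.
    have denE : n%:R ^+ 2 * ratr x - (n%:R - 1) = ratr (H ^+ 2 * x - (H - 1)) :> R.
      by rewrite !rmorphB rmorph1 rmorphM rmorphXn rmorph_nat.
    have numE : (n%:R + 1) * ratr x - 1 = ratr ((H + 1) * x - 1) :> R.
      by rewrite rmorphB rmorph1 rmorphM rmorphD rmorph1 rmorph_nat.
    rewrite /T12 /= denE numE -!fmorph_div.
    have := @fringe_length_moebius R w (n%:Z + 1) (- 1) (n%:Z ^+ 2) (1 - n%:Z) x n0 hb0.
    have -> : (n%:Z + 1)%:~R = H + 1 :> rat by rewrite intrD.
    have -> : (n%:Z ^+ 2)%:~R = H ^+ 2 :> rat by rewrite rmorphXn.
    have -> : (1 - n%:Z)%:~R = - (H - 1) :> rat by rewrite intrB opprB.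
    rewrite mulrNz => ->//.
    * by ring.
    * by rewrite expr2 dvdz_mulr.
    * by rewrite addrAC subrr add0r rpredN dvdzz.
    * by move: x0 H1 => ? ?; nra.
    * by rewrite divr_gt0.
  + move=> y; rewrite !ratr_itv => /andP[y0]; rewrite ltr_pdivlMr; last by lra.
    move=> y1; have E0 : 0 < H + 1 - H ^+ 2 * y.
      have : 0 < H * (1 - y * H) by rewrite mulr_gt0; lra.
      by lra.
    split.
      apply/andP; split.
        rewrite ltr_pdivlMr// mulrAC ltr_pdivrMr; lra.
      rewrite ltr_pdivrMr// mulrAC ltr_pdivlMr; lra.
    (* The two denominators are inverse to each other since the matrix has
       determinant one. *)
    have -> : H ^+ 2 * ((1 - (H - 1) * y) / (H + 1 - H ^+ 2 * y)) - (H - 1)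
        = (H + 1 - H ^+ 2 * y)^-1 by field; lra.
    by field; lra.
  + move=> x; rewrite !ratr_itv => /andP[x0 x1].
    rewrite ltr_pdivrMr in x0; last by lra.
    rewrite ltr_pdivlMr in x1; last by lra.
    have d0 := den0 x x0.
    have -> : H + 1 - H ^+ 2 * (((H + 1) * x - 1) / (H ^+ 2 * x - (H - 1)))
        = (H ^+ 2 * x - (H - 1))^-1 by field; lra.
    by field; lra.
Qed.
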